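(* Let $P$ be a convex body in $\mathbb{R}^n$ and let $\mu$ be a positive Borel measure on $\mathbb{R}^n$ such that $\mu (\mathbb{R}^n)= \int_{\mathbb{R}^n} \mathrm{MA}_{\mathbb{R}}(h_P)$. Then there exists $h\in \mathcal{E}_P(\mathbb{R}^n)$, unique up to an additive constant, such that $$\mathrm{MA}_{\mathbb{R}}(h)=\mu.$$
   Context: A convex body $P\subset\mathbb R^n$ is a compact convex subset with non-empty interior; its support function is $h_P(x)=\sup_{p\in P}\langle x,p\rangle$. For a convex function $h:\mathbb R^n\to\mathbb R$, the sub-gradient at $x$ is $dh(x)=\{q\in\mathbb R^n: h(y)\ge h(x)+\langle q,y-x\rangle\ \forall y\in\mathbb R^n\}$, and $dh(E)=\bigcup_{x\in E}dh(x)$. The real Monge-Ampère measure (in the sense of Alexandrov) is $\mathrm{MA}_{\mathbb R}(h)(E)=\frac{n!}{2^n}\mathrm{Vol}_n(dh(E))$ for Borel sets $E\subset\mathbb R^n$, where $\mathrm{Vol}_n$ is Lebesgue measure. $\mathcal L_P(\mathbb R^n)$ is the set of convex functions $h:\mathbb R^n\to\mathbb R$ with $h\le h_P+C$ for some $C\in\mathbb R$, and $\mathcal E_P(\mathbb R^n):=\{h\in\mathcal L_P(\mathbb R^n):\int_{\mathbb R^n}\mathrm{MA}_{\mathbb R}(h)=\int_{\mathbb R^n}\mathrm{MA}_{\mathbb R}(h_P)\}$. *)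

(* Defs.v *)
From HB Require Import structures.
From mathcomp Require Import all_boot all_order all_algebra.
From mathcomp Require Import all_classical all_reals all_analysis.

Set Implicit Arguments.
Unset Strict Implicit.
Unset Printing Implicit Defensive.

Import Order.TTheory GRing.Theory Num.Theory.
Import numFieldNormedType.Exports.

Local Open Scope classical_set_scope.
Local Open Scope ring_scope.

Notation borel_rV R n := (g_sigma_algebraType (@open 'rV[R]_n)).

Section RealMongeAmpere.
Variables (R : realType) (n : nat).
Local Notation E := 'rV[R]_n.
Implicit Types (x y p q : E) (P : set E) (h : E -> R).

Definition dotv x y : R := \sum_(i < n) x 0 i * y 0 i.

Definition box (B : E * E) : set E :=
  [set x | forall i, B.1 0 i < x 0 i <= B.2 0 i].

Definition box_vol (B : E * E) : R :=
  \prod_(i < n) Num.max 0 (B.2 0 i - B.1 0 i).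

(* n-dimensional Lebesgue outer measure: it agrees with Lebesgue measure on
   every Lebesgue measurable set. It is not restricted to Borel sets because
   the image of a Borel set under a subdifferential is Lebesgue measurable but
   need not be Borel. The covering families are countable, possibly finite, so
   that the definition is also correct for n = 0, where the only box is the
   whole space and has volume 1. *)
Definition Vol (A : set E) : \bar R :=
  ereal_inf [set (\esum_(B in F) (box_vol B)%:E)%E | F in
    [set F : set (E * E) | countable F /\ A `<=` \bigcup_(B in F) box B]].

Definition convex_body P : Prop :=
  [/\ compact P, convex_set (P : set (convex_lmodType E)) & P° !=set0].

Definition support_function P x : R := sup [set dotv x p | p in P].

Definition convex_on_rV h : Prop :=
  convex_function [set: convex_lmodType E] h.

Definition subgradient h x : set E :=
  [set q | forall y, h x + dotv q (y - x) <= h y].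

Definition subgradient_image h (A : set E) : set E :=
  \bigcup_(x in A) subgradient h x.

(* A measure only on the Borel sets: equalities between [MA h] and a Borel
   measure are to be stated on those. *)
Definition MA h (A : set E) : \bar R :=
  ((n`!%:R / 2 ^+ n)%:E * Vol (subgradient_image h A))%E.

Definition class_L P : set (E -> R) :=
  [set h | convex_on_rV h /\
           exists C : R, forall x, h x <= support_function P x + C].

(* The integral over the whole space of the constant 1 against a measure is
   the value of the measure on [setT]. *)
Definition class_E P : set (E -> R) :=
  [set h | class_L P h /\ MA h setT = MA (support_function P) setT].

End RealMongeAmpere.

(* Main.v *)
Require Import Defs.
From HB Require Import structures.
From mathcomp Require Import all_boot all_order all_algebra.
From mathcomp Require Import all_classical all_reals all_analysis.
From mathcomp Require Import finmap ring lra.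
Import Order.TTheory GRing.Theory Num.Theory.
Import numFieldNormedType.Exports.
Local Open Scope classical_set_scope.
Local Open Scope ring_scope.

Set Implicit Arguments.
Unset Strict Implicit.
Unset Printing Implicit Defensive.

(** The theorem is the second boundary value problem for the Monge-Ampere equation
    with target [P]. Up to the constant [n! / 2^n], it asks for a convex [h] whose
    subgradient map carries the measure [mu] on [R^n] to the volume on [P].

    The class [class_L P] is, among convex functions, the class of those with
    [h y - h x <= h_P (y - x)] ([class_L_lipschitz], [lipschitz_class_L]). For such
    an [h] all subgradients lie in [P], and the set of points [p] that are
    subgradients at two different points is null ([Vol_multi_subgradient]).
    Therefore images under the subgradient map of disjoint sets are almost disjoint,
    and [A |-> Vol (dh(A))] is a Borel measure of mass at most [Vol P]
    ([subgradient_measure]).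

    Existence. The functions [h] of the class with [h 0 = 0] form a compact set for
    pointwise convergence, on which [h |-> Vol (dh(K))] is upper semicontinuous for
    every compact [K] ([subgradient_image_usc]). Hence, by the finite intersection
    property, an [h] with [mu K <= Vol (dh(K))] for all compact [K] exists as soon
    as one exists for any finitely many [K] ([exists_dominating]). In that case [mu]
    may be concentrated on one point of each atom of the Boolean algebra generated
    by these [K], and the problem becomes semidiscrete: find weights such that the
    cells of a power diagram have given volumes in [P], which a minimality argument
    provides ([semidiscrete]). Finally, two finite measures of the same mass, one of
    which dominates the other on compact sets, coincide ([exists_solution]).

    Uniqueness. Let [h] and [g] be two solutions. Comparing the volumes of the
    images of the sets [c < h - g] shows that almost every [p] in [P] is a
    subgradient of [h] and of [g] at a common point ([common_subgradient]). So the
    convex conjugates of [h] and [g] have a common subgradient almost everywhere,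
    and their difference is constant along almost every segment issued from a
    given point ([gap_constant]). A solution is recovered from its affine minorants
    with slopes in a set of full measure ([gap_le]), and [h - g] is constant.

    The volume is given as an outer measure on boxes, so its theory comes first: open
    sets are measurable and have positive volume ([measurable_open],
    [Vol_open_gt0]), it is outer regular ([Vol_outer_regular]), it behaves well under
    dilations ([Vol_affine_le]), and a compact set that is disjoint from its
    translates along some vector is null ([Vol0_of_transverse]). *)

(** * Sums over countable families *)

Section EsumFacts.
Context {R : realType}.
Local Open Scope ereal_scope.

Lemma esum_subset (T : choiceType) (I J : set T) (a : T -> \bar R) :
  I `<=` J -> (forall x, 0 <= a x) ->
  \esum_(x in I) a x <= \esum_(x in J) a x.
Proof.
move=> IJ a0; rewrite [leLHS]esum_mkcond [leRHS]esum_mkcond.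
apply: le_esum => x _; case: ifPn => [xI|_]; last by case: ifP.
by rewrite ifT//; apply/mem_set/IJ/set_mem.
Qed.

(** Several indices may have the same image, which is counted once on the left. *)
Lemma le_esum_image (T T' : choiceType) (I : set T) (f : T -> T')
    (a : T' -> \bar R) : (forall y, 0 <= a y) ->
  \esum_(y in f @` I) a y <= \esum_(x in I) a (f x).
Proof.
move=> a0; have [->|/set0P[x0 Ix0]] := eqVneq I set0.
  by rewrite image_set0 !esum_set0.
pose s y := xget x0 [set x | I x /\ f x = y].
have sP y : (f @` I) y -> I (s y) /\ f (s y) = y.
  by move=> [x Ix <-]; apply: (@xgetPex _ x0 [set z | I z /\ f z = f x]); exists x.
have -> : f @` I = f @` (s @` (f @` I)).
  apply/seteqP; split=> y.
    by move=> fy; have [? fsy] := sP _ fy; exists (s y) => //; exists y.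
  by move=> [x [z /sP[Isz _] <-] <-]; exists (s z).
rewrite esum_image; last first.
  move=> _ _ /set_mem[u fu <-] /set_mem[v fv <-].
  by rewrite (sP _ fu).2 (sP _ fv).2 => ->.
by apply: esum_subset => // x [y /sP[Isy _] <-].
Qed.

Lemma esumZ_le (T : choiceType) (I : set T) (c : R) (a : T -> \bar R) :
  (0 <= c)%R -> (forall x, 0 <= a x) ->
  \esum_(x in I) (c%:E * a x) <= c%:E * \esum_(x in I) a x.
Proof.
move=> c0 a0; apply: ge_ereal_sup => _ [X [finX XI] <-].
rewrite -ge0_mule_fsumr// lee_wpmul2l// esum_ge//.
by exists X.
Qed.

End EsumFacts.

(** * Lebesgue outer measure *)

(** Measurability in the sense of Caratheodory for the outer measure [Vol]. *)
Notation lebesgue_measurable :=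
  (measurable : set (set (caratheodory_type (@Vol _ _)))).

Section Volume.
Context {R : realType} {n : nat}.
Local Notation E := 'rV[R]_n.
Implicit Types (A U : set E) (B : E * E).
Local Open Scope ereal_scope.

Lemma box_vol_ge0 B : (0 <= box_vol B)%R.
Proof. by apply: prodr_ge0 => i _; rewrite le_max lexx. Qed.

Lemma box_volE_ge0 B : 0 <= (box_vol B)%:E.
Proof. by rewrite lee_fin box_vol_ge0. Qed.
#[local] Hint Resolve box_volE_ge0 : core.

Lemma Vol_ge0 A : 0 <= Vol A.
Proof. by apply: le_ereal_inf_tmp => _ [F _ <-]; apply: esum_ge0. Qed.
#[local] Hint Resolve Vol_ge0 : core.

(** A family of boxes indexed with repetitions is a cover of no smaller sum, so that
    covers can be indexed by any countable set. *)
Lemma Vol_le_esum (T : choiceType) (I : set T) (B : T -> E * E) A :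
  countable I -> A `<=` \bigcup_(i in I) box (B i) ->
  Vol A <= \esum_(i in I) (box_vol (B i))%:E.
Proof.
move=> cI AB; apply: ge_ereal_inf; exists (\esum_(C in B @` I) (box_vol C)%:E).
  exists (B @` I) => //; split.
    by apply: (sub_countable (card_image_le _ _)).
  by move=> x /AB[i Ii Bix]; exists (B i) => //; exists i.
exact: (le_esum_image _ B box_volE_ge0).
Qed.

Lemma Vol_cover A (e : R) : (0 < e)%R -> Vol A < +oo ->
  exists F : set (E * E), [/\ countable F, A `<=` \bigcup_(B in F) box B &
    \esum_(B in F) (box_vol B)%:E <= Vol A + e%:E].
Proof.
move=> e0 Aoo; have /(lb_ereal_inf_adherent e0) : Vol A \is a fin_num.
  by rewrite ge0_fin_numE.
by move=> [_ [F [cF AF] <-]] /ltW Fe; exists F.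
Qed.

Lemma Vol_set0 : Vol (set0 : set E) = 0.
Proof.
apply/eqP; rewrite eq_le Vol_ge0 andbT.
by rewrite (le_trans (@Vol_le_esum _ set0 id _ _ _))// esum_set0.
Qed.

Lemma Vol_le A A' : A `<=` A' -> Vol A <= Vol A'.
Proof.
move=> AA'; apply: ereal_inf_le_tmp => _ [F [cF A'F] <-].
by exists F => //; split => //; apply: subset_trans A'F.
Qed.

Lemma Vol_sigma_subadditive : sigma_subadditive (@Vol R n).
Proof.
move=> F; have [[i Fioo]|/forallNP Foo] := pselect (exists i, Vol (F i) = +oo).
  rewrite (eseries_pinfty _ _ Fioo) ?leey// => k _.
  by rewrite -ltNye (lt_le_trans _ (Vol_ge0 _)).
apply/lee_addgt0Pr => e e0.
rewrite (le_trans _ (epsilon_trick _ _ _))//; last exact: ltW.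
have /choice[G GP] k : exists G : set (E * E), [/\ countable G,
    F k `<=` \bigcup_(B in G) box B &
    \esum_(B in G) (box_vol B)%:E <= Vol (F k) + (e / (2 ^ k.+1)%:R)%:E].
  apply: Vol_cover; first by rewrite divr_gt0// ltr0n expn_gt0.
  by rewrite ltey; apply/eqP/Foo.
pose B (p : nat * (E * E)) := p.2.
apply: (le_trans (@Vol_le_esum _ (setT `*`` G) B _ _ _)).
- by by apply: countableXR; [exact: countableP|move=> k _; case: (GP k)].
- move=> x [k _]; case: (GP k) => _ Fk _ /Fk[C GC Cx].
  by exists (k, C).
rewrite -(esum_esum (a := fun k C => (box_vol C)%:E))// -nneseries_esumT.
  apply: lee_nneseries => [k _ _|k _]; first exact: esum_ge0.
  by case: (GP k).
by move=> k; exact: esum_ge0.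
Qed.

HB.instance Definition _ := isOuterMeasure.Build R E (@Vol R n)
  Vol_set0 Vol_ge0 Vol_le Vol_sigma_subadditive.

Lemma Vol_box B : Vol (box B) <= (box_vol B)%:E.
Proof.
rewrite (le_trans (@Vol_le_esum _ [set B] id _ _ _))//; last by rewrite esum_set1.
by move=> x Bx; exists B.
Qed.

Lemma Vol_setU A A' : Vol (A `|` A') <= Vol A + Vol A'.
Proof. exact: outer_measureU2. Qed.

(** The map [x |-> a x + v] takes boxes to boxes. Applied also to the inverse map
    for [a = 1], this gives translation invariance. *)
Lemma Vol_affine_le A (a : R) (v : E) : (0 < a)%R ->
  Vol [set (a *: x + v)%R | x in A] <= (a ^+ n)%:E * Vol A.
Proof.
move=> a0; have an0 : (0 < a ^+ n)%R by rewrite exprn_gt0.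
have [Aoo|Aoo] := eqVneq (Vol A) +oo; first by rewrite Aoo gt0_muley ?leey.
apply/lee_addgt0Pr => e e0.
have [||F [cF AF Fe]] := @Vol_cover A (e / a ^+ n).
- by rewrite divr_gt0.
- by rewrite ltey.
pose f B : E * E := (a *: B.1 + v, a *: B.2 + v)%R.
have volf B : (box_vol (f B))%:E = (a ^+ n)%:E * (box_vol B)%:E.
  rewrite -EFinM; congr EFin; rewrite /box_vol -[in (a ^+ n)%R](card_ord n).
  rewrite -prodr_const -big_split/=; apply: eq_bigr => i _.
  rewrite !mxE maxr_pMr ?ltW// mulr0; congr Num.max; ring.
apply: (le_trans (@Vol_le_esum _ F f _ cF _)).
  move=> _ [x /AF[B FB Bx] <-]; exists B => // i; have /andP[B1 B2] := Bx i.
  by rewrite !mxE ltrD2r lerD2r ltr_pM2l// ler_pM2l// B1 B2.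
under eq_esum do rewrite volf.
have -> : e%:E = (a ^+ n)%:E * (e / a ^+ n)%:E.
  by rewrite -EFinM mulrCA divff ?mulr1// gt_eqF.
rewrite -ge0_muleDr//; last by rewrite lee_fin divr_ge0 ?ltW.
by apply: (le_trans (esumZ_le _ (ltW an0) _)) => //; rewrite lee_wpmul2l// lee_fin ltW.
Qed.


Local Close Scope ereal_scope.


Lemma cut_length (l u a : R) :
  Num.max 0 (Num.min u a - l) + Num.max 0 (u - Num.max l a) = Num.max 0 (u - l).
Proof.
have [ua|au] := leP u a.
  by rewrite [X in _ + X]max_l ?addr0// subr_le0 le_max ua orbT.
have [la|al] := leP l a.
  by rewrite !max_r ?subr_ge0 ?(le_trans la)// 1?ltW//; ring.
by rewrite [X in X + _]max_l ?add0r// subr_le0 ltW.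
Qed.

Lemma box_cut (i : 'I_n) (a : R) B :
  exists B1 B2, [/\ (box_vol B1 + box_vol B2 = box_vol B),
    box B `&` [set x | x 0 i <= a] `<=` box B1 &
    box B `&` [set x | a < x 0 i] `<=` box B2].
Proof.
exists (B.1, \row_j if j == i then Num.min (B.2 0 i) a else B.2 0 j).
exists (\row_j if j == i then Num.max (B.1 0 i) a else B.1 0 j, B.2); split.
- have vol (C : E * E) : (forall j, j != i -> C.1 0 j = B.1 0 j /\ C.2 0 j = B.2 0 j) ->
      box_vol C = Num.max 0 (C.2 0 i - C.1 0 i) *
        \prod_(j < n | j != i) Num.max 0 (B.2 0 j - B.1 0 j).
    by move=> CB; rewrite /box_vol (bigD1 i)//=; congr (_ * _);
      apply: eq_bigr => j /CB[-> ->].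
  rewrite !vol//; last 2 first.
  - by move=> j /negbTE ji; rewrite !mxE ji.
  - by move=> j /negbTE ji; rewrite !mxE ji.
  rewrite -mulrDl; congr (_ * _); rewrite !mxE eqxx.
  exact: cut_length.
- move=> x [Bx /= xa] j; rewrite !mxE; have /andP[B1 B2] := Bx j.
  by case: eqVneq => [->|_]; rewrite ?B1//= le_min xa andbT; have /andP[] := Bx i.
- move=> x [Bx /= xa] j; rewrite !mxE; have /andP[B1 B2] := Bx j.
  case: eqVneq => [->|_]; rewrite ?B1 ?B2//= gt_max xa andbT.
  by have := Bx i.
Qed.

(** A half-space cuts each box of a cover into two boxes whose volumes add up. *)
Lemma measurable_halfspace (i : 'I_n) (a : R) :
  lebesgue_measurable [set x | x 0 i <= a].
Proof.
apply: le_caratheodory_measurable => X.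
have [Xoo|Xoo] := eqVneq (Vol X) +oo%E; first by rewrite [leRHS]Xoo leey.
apply/lee_addgt0Pr => e e0.
have [||F [cF XF Fe]] := @Vol_cover X e => //; first by rewrite ltey.
have /choice[L /choice[G LG]] := box_cut i a.
apply: le_trans Fe.
under eq_esum do rewrite -(let: And3 h _ _ := LG _ in h) EFinD.
rewrite esumD//; apply: leeD; apply: Vol_le_esum => // x [/XF[B FB Bx] xa];
  exists B => //; case: (LG B) => _ h1 h2.
- exact: h1.
- by apply: h2; split => //=; rewrite ltNge; apply/negP.
Qed.

Lemma measurable_box B : lebesgue_measurable (box B).
Proof.
have -> : box B = \bigcap_(i in [set: 'I_n])
    (~` [set x | x 0 i <= B.1 0 i] `&` [set x | x 0 i <= B.2 0 i]).
  apply/seteqP; split=> x Bx i.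
    by move=> _; have /andP[B1 B2] := Bx i; split => //=; apply/negP; rewrite -ltNge.
  by have [/= /negP B1 B2] := Bx i Logic.I; rewrite ltNge B1 B2.
apply: fin_bigcap_measurable => // i _.
apply: measurableI; last exact: measurable_halfspace.
by apply: measurableC; exact: measurable_halfspace.
Qed.

(** An open set is the union of the boxes of the lattices of mesh [1 / N.+1] that it
    contains. *)
Lemma measurable_open U : open U -> lebesgue_measurable U.
Proof.
move=> oU.
pose Bx (p : nat * {ffun 'I_n -> int}) : E * E :=
  (\row_i ((p.2 i)%:~R / p.1.+1%:R), \row_i ((p.2 i + 1)%:~R / p.1.+1%:R)).
have -> : U = \bigcup_(p in [set p | box (Bx p) `<=` U]) box (Bx p).
  apply/seteqP; split=> [x Ux|x [p pU]]; last exact: pU.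
  have /nbhs_ballP[e /= e0 xeU] : nbhs x U by exact: open_nbhs_nbhs.
  have [N] := ltr_add_invr e0; rewrite add0r => Ne.
  pose k := [ffun i : 'I_n => (Num.ceil (x 0 i * N.+1%:R) - 1)].
  have kP i : ((k i)%:~R / N.+1%:R < x 0 i <= (k i + 1)%:~R / N.+1%:R).
    rewrite ltr_pdivrMr// ler_pdivlMr// /k ffunE subrK ceil_ge.
    by rewrite ceilB1_lt.
  exists (N, k); last by move=> i; rewrite !mxE kP.
  move=> y By; apply: xeU; split => // i j; rewrite ord1.
  have /andP[x1 x2] := kP j; have /andP[y1 y2] := By j.
  have kk : (k j + 1)%:~R / N.+1%:R = (k j)%:~R / N.+1%:R + N.+1%:R^-1 :> R.
    by rewrite intrD mulrDl mul1r.
  rewrite !mxE/= in y1 y2; rewrite kk in x2 y2.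
  rewrite /ball /= ltr_distlC; move: x1 x2 y1 y2 Ne {kk}.
  move: ((k j)%:~R / N.+1%:R : R) (N.+1%:R^-1 : R) => a d *; lra.
rewrite bigcup_mkcond; apply: countable_bigcupT_measurable => [|p]; first exact: countableP.
by case: ifP => _ //; exact: measurable_box.
Qed.

Lemma measurable_closed (C : set E) : closed C -> lebesgue_measurable C.
Proof.
by rewrite -openC -{2}(setCK C) => /measurable_open; exact: measurableC.
Qed.

Lemma compact_closed_rV (K : set E) : compact K -> closed K.
Proof. by apply: compact_closed; exact: norm_hausdorff. Qed.

Lemma measurable_compact (K : set E) : compact K -> lebesgue_measurable K.
Proof. by move=> /compact_closed_rV/measurable_closed. Qed.

Lemma measurable_null (N : set E) : Vol N = 0%E -> lebesgue_measurable N.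
Proof.
move=> N0; apply: le_caratheodory_measurable => X.
rewrite -[leRHS]add0e -[X in (_ <= X + _)%E]N0.
by apply: leeD; apply: Vol_le; apply: subIset; [right|left].
Qed.

Lemma Vol_null_sub (N M : set E) : N `<=` M -> Vol M = 0%E -> Vol N = 0%E.
Proof.
by move=> NM M0; apply/eqP; rewrite eq_le Vol_ge0 andbT -M0 Vol_le.
Qed.

Lemma Vol_nullU (N M : set E) : Vol N = 0%E -> Vol M = 0%E ->
  Vol (N `|` M) = 0%E.
Proof.
move=> N0 M0; apply/eqP; rewrite eq_le Vol_ge0 andbT.
by apply: le_trans (Vol_setU _ _) _; rewrite N0 M0 adde0.
Qed.

Lemma Vol_null_bigcup (T : countType) (D : set T) (F : T -> set E) :
  (forall i, D i -> Vol (F i) = 0%E) -> Vol (\bigcup_(i in D) F i) = 0%E.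
Proof.
move=> F0; pose G k : set E :=
  if @choice.unpickle T k is Some i then [set x | D i /\ F i x] else set0.
apply: (@Vol_null_sub _ (\bigcup_k G k)).
  by move=> x [i Di Fx]; exists (choice.pickle i) => //; rewrite /G choice.pickleK.
apply/eqP; rewrite eq_le Vol_ge0 andbT.
apply: le_trans (Vol_sigma_subadditive _) _; rewrite eseries0// => k _ _.
rewrite /G; case: choice.unpickle => [i|]; last exact: Vol_set0.
have [Di|Di] := pselect (D i).
  by apply: Vol_null_sub (F0 i Di) => x [].
by apply: Vol_null_sub Vol_set0 => x [].
Qed.

Lemma coord_le_norm (x : E) i : `|x 0 i| <= `|x|.
Proof.
by rewrite [leRHS]/Num.norm/= mx_normrE; apply: (le_bigmax _ _ (0, i)).
Qed.

Lemma norm_le_coord (x : E) (M : R) : 0 <= M -> (forall i, `|x 0 i| <= M) ->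
  `|x| <= M.
Proof.
move=> M0 xM; rewrite [leLHS]/Num.norm/= mx_normrE; apply/bigmax_leP; split=> //.
by move=> [i j] _ /=; rewrite ord1.
Qed.

Lemma Vol_bounded A : bounded_set A -> (Vol A < +oo)%E.
Proof.
move=> /ex_strict_bound_gt0[M M0 AM].
pose B : E * E := (const_mx (- M), const_mx M).
apply: le_lt_trans (ltry (box_vol B)); apply: le_trans (Vol_box B).
apply: Vol_le => x /AM xM i; rewrite !mxE.
have := le_lt_trans (coord_le_norm x i) xM.
by rewrite ltr_norml => /andP[-> /ltW].
Qed.

Lemma Vol_compact (K : set E) : compact K -> (Vol K < +oo)%E.
Proof. by move=> /compact_bounded/Vol_bounded. Qed.

Lemma continuous_prod_shift (a : 'I_n -> R) :
  continuous (fun t : R => \prod_(i < n) (a i + t)).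
Proof.
apply: (@continuous_big R 'I_n *%R 1 xpredT _ R _ (fun i t => a i + t)).
  exact: mul_continuous.
by move=> i _ t; apply: cvgD; [exact: cvg_cst|exact: cvg_id].
Qed.

(** The volume depends continuously on the size of the box; the sides are first
    replaced by their positive parts, to cover the case of an empty box. *)
Lemma box_enlarge B (e : R) : 0 < e ->
  exists B', box_vol B' <= box_vol B + e /\ box B `<=` (box B')°.
Proof.
move=> e0.
have [t t0 te] : exists2 t, 0 < t &
    \prod_(i < n) (Num.max 0 (B.2 0 i - B.1 0 i) + t) <= box_vol B + e.
  have := @continuous_prod_shift (fun i => Num.max 0 (B.2 0 i - B.1 0 i)).
  move=> /(_ 0)/cvgrPdist_lt/(_ _ e0)/nbhs_ballP[d /= d0 dP].
  exists (d / 2); first by rewrite divr_gt0.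
  have /dP : ball 0 d (d / 2) by rewrite /ball/= sub0r normrN gtr0_norm; lra.
  under [X in `|X - _|]eq_bigr do rewrite addr0.
  rewrite ltr_norml -/(box_vol B) => /andP[]; lra.
exists (B.1, B.2 + const_mx t); split.
  apply: le_trans te; apply: ler_prod => i _; rewrite le_max lexx/= !mxE.
  rewrite ge_max; apply/andP; split; first by rewrite addr_ge0 ?le_max ?lexx//= ltW.
  by rewrite addrAC lerD2r le_max lexx orbT.
move=> x Bx.
apply: (@filter_forall _ _ (fun i (y : E) =>
  B.1 0 i < y 0 i <= (B.2 + const_mx t) 0 i) (nbhs x)) => i.
have /andP[Bi1 Bi2] := Bx i; near=> y; rewrite !mxE; apply/andP; split.
- near: y; exact: (@coord_continuous R 1 n 0 i x _ (lt_nbhsr Bi1)).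
- apply/ltW; near: y; have Bt : x 0 i < B.2 0 i + t by rewrite (le_lt_trans Bi2)// ltrDl.
  exact: (@coord_continuous R 1 n 0 i x _ (lt_nbhsl Bt)).
Unshelve. all: by end_near. Qed.

(** The boxes of a cover, numbered injectively by [k], are enlarged at a cost
    summable to [e / 2]. *)
Lemma Vol_cover_open A (e : R) : 0 < e -> (Vol A < +oo)%E ->
  exists F : set (E * E), [/\ countable F, A `<=` \bigcup_(B in F) (box B)° &
    (\esum_(B in F) (box_vol B)%:E <= Vol A + e%:E)%E].
Proof.
move=> e0 Aoo; have e20 : 0 < e / 2 by rewrite divr_gt0.
have [F [cF AF Fe]] := Vol_cover e20 Aoo.
have [k kinj] : exists k : E * E -> nat, set_inj F k.
  by have [k] := countable_injP _ cF; exists k.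
have /choice[g gP] B : exists B', box_vol B' <= box_vol B + e / 2 / (2 ^ (k B).+1)%:R
    /\ box B `<=` (box B')°.
  by apply: box_enlarge; rewrite divr_gt0// ltr0n expn_gt0.
exists (g @` F); split.
- by apply: (sub_countable (card_image_le _ _)).
- move=> x /AF[B FB Bx]; exists (g B); first by exists B.
  by case: (gP B) => _; exact.
- apply: le_trans (le_esum_image _ _ box_volE_ge0) _.
  apply: (@le_trans _ _ (\esum_(B in F) ((box_vol B)%:E +
    (e / 2 / (2 ^ (k B).+1)%:R)%:E))%E).
    by apply: le_esum => B FB; rewrite -EFinD lee_fin; case: (gP B).
  have p0 j : (0 <= (e / 2 / (2 ^ j.+1)%:R)%:E)%E.
    by rewrite lee_fin divr_ge0 ?ltW.
  rewrite esumD//.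
  rewrite [in leRHS](splitr e) EFinD addeA leeD//.
  rewrite -(esum_image _ _ (fun j => (e / 2 / (2 ^ j.+1)%:R)%:E))//.
  apply: le_trans (esum_subset (@subsetT _ _) p0) _.
  by rewrite -nneseries_esumT// epsilon_trick0// ltW.
Qed.

Lemma Vol_outer_regular A (c : R) : (Vol A < c%:E)%E ->
  exists U, [/\ open U, A `<=` U & (Vol U < c%:E)%E].
Proof.
move=> Ac; have Aoo : (Vol A < +oo)%E by rewrite (lt_trans Ac)// ltry.
have VA : Vol A = (fine (Vol A))%:E by rewrite fineK// ge0_fin_numE// Vol_ge0.
have e0 : 0 < (c - fine (Vol A)) / 2.
  by rewrite divr_gt0// subr_gt0 -lte_fin -VA.
have [F [cF AF Fe]] := Vol_cover_open e0 Aoo.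
exists (\bigcup_(B in F) (box B)°); split => //.
  by apply: bigcup_open => B _; exact: open_interior.
apply: (@le_lt_trans _ _ (Vol A + ((c - fine (Vol A)) / 2)%:E)%E).
  apply: le_trans Fe; apply: (@Vol_le_esum _ F id) => //.
  by move=> x [B FB Bx]; exists B => //; exact: interior_subset.
rewrite VA -EFinD lte_fin; rewrite VA lte_fin in Ac; lra.
Qed.


(** The additional 1 is a boundary effect, negligible in the limit of fine lattices. *)
Lemma count_itv_le (u v : R) (m : nat) :
  \sum_(j < m) (u < j%:R <= v)%R%:R <= Num.max 0 (v - u) + 1.
Proof.
have S m' : \sum_(j < m') (u < j%:R <= v)%R%:R <= Num.max 0 (m'%:R - u).
  elim: m' => [|k IH]; first by rewrite big_ord0 le_max lexx.
  rewrite big_ord_recr/= le_max; have [uk|ku] := ltP u k%:R; last first.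
    by rewrite addr0 (le_trans IH)// max_l ?lexx// subr_le0.
  apply/orP; right; rewrite -natr1 addrAC; apply: lerD; last by rewrite lern1 leq_b1.
  by apply: le_trans IH _; rewrite max_r// subr_ge0 ltW.
elim: m => [|m IH].
  by rewrite big_ord0 addr_ge0// le_max lexx.
have := S m.+1; rewrite big_ord_recr/=.
case: ltP => [um|_] /=; last by rewrite addr0.
have [mv|_] := leP m%:R v; last by rewrite addr0.
move=> /le_trans; apply; rewrite -natr1 !max_r; lra.
Qed.

(** Counting the points of the lattice of mesh [1 / N.+1] in the cube and in the
    boxes bounds 1 by a perturbation of the sum of the volumes, which tends to it as
    [N] grows. *)
Lemma cube_cover_vol (s : seq (E * E)) :
  (forall x : E, (forall i, 0 <= x 0 i <= 1) -> exists2 B, B \in s & box B x) ->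
  1 <= \sum_(B <- s) box_vol B.
Proof.
move=> cov.
pose g (t : R) := \sum_(B <- s) \prod_(i < n) (Num.max 0 (B.2 0 i - B.1 0 i) + t).
have g_ge1 N : 1 <= g N.+1%:R^-1.
  have N0 : 0 < N.+1%:R :> R by [].
  pose pt (f : {ffun 'I_n -> 'I_N.+1}) : E := \row_i ((f i)%:R / N.+1%:R).
  have pt_cov (f : {ffun 'I_n -> 'I_N.+1}) : 1 <= \sum_(B <- s) \prod_(i < n)
      (B.1 0 i * N.+1%:R < (f i)%:R <= B.2 0 i * N.+1%:R)%R%:R :> R.
    have [|B Bs Bf] := cov (pt f).
      move=> i; rewrite mxE divr_ge0//= ler_pdivrMr// mul1r ler_nat.
      exact: ltnW.
    rewrite (big_rem B)//= big1 => [|i _].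
      by rewrite lerDl; apply: sumr_ge0 => C _; exact: prodr_ge0.
    by have := Bf i; rewrite mxE ltr_pdivlMr// ler_pdivrMr// => ->.
  have : (N.+1%:R : R) ^+ n <= \sum_(B <- s) \prod_(i < n)
      (N.+1%:R * (Num.max 0 (B.2 0 i - B.1 0 i) + N.+1%:R^-1)).
    have -> : (N.+1%:R : R) ^+ n = \sum_(f : {ffun 'I_n -> 'I_N.+1}) 1.
      by rewrite sumr_const card_ffun !card_ord natrX.
    apply: le_trans (ler_sum _ (fun f _ => pt_cov f)) _.
    rewrite exchange_big/=; apply: ler_sum => B _.
    rewrite -(bigA_distr_bigA (fun i (j : 'I_N.+1) =>
      (B.1 0 i * N.+1%:R < j%:R <= B.2 0 i * N.+1%:R)%R%:R : R)).
    apply: ler_prod => i _; apply/andP; split.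
      by apply: sumr_ge0 => j _; exact: ler0n.
    apply: le_trans (count_itv_le _ _ _) _.
    rewrite mulrDr mulfV ?gt_eqF// lerD2r maxr_pMr ?ler0n// mulr0.
    by rewrite mulrBr !(mulrC N.+1%:R).
  have -> : \sum_(B <- s) \prod_(i < n)
      (N.+1%:R * (Num.max 0 (B.2 0 i - B.1 0 i) + N.+1%:R^-1)) =
      N.+1%:R ^+ n * g N.+1%:R^-1.
    rewrite /g mulr_sumr; apply: eq_bigr => B _.
    by rewrite big_split prodr_const card_ord.
  by rewrite -{1}[_ ^+ n]mulr1 ler_pM2l// exprn_gt0.
have cg : continuous g.
  rewrite /g; elim: (s) => [|B s' IH] t.
    by under eq_fun do rewrite big_nil; exact: cvg_cst.
  under eq_fun do rewrite big_cons.
  apply: (@continuousD _ _ _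
    (fun t => \prod_(i < n) (Num.max 0 (B.2 0 i - B.1 0 i) + t))); last exact: IH.
  exact: continuous_prod_shift.
have -> : \sum_(B <- s) box_vol B = g 0.
  by apply: eq_bigr => B _; apply: eq_bigr => i _; rewrite addr0.
rewrite leNgt; apply/negP => g0.
have /cg/nbhs_ballP[d /= d0 dg] : nbhs (g 0) [set r | r < 1] by exact: lt_nbhsl.
have [N] := ltr_add_invr d0; rewrite add0r => Nd.
have : g N.+1%:R^-1 < 1 by apply: dg; rewrite /ball/= sub0r normrN gtr0_norm.
by rewrite ltNge g_ge1.
Qed.

Lemma Vol_cube_gt0 : (0 < Vol [set x : E | forall i, (0 <= x 0 i <= 1)%R])%E.
Proof.
set Q := [set x | _].
have cQ : compact Q.
  have -> : Q = [set x : E | forall i, `[0, 1]%classic (x ord0 i)].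
    by apply/seteqP; split=> x Qx i; have := Qx i; rewrite /= in_itv.
  by apply: (@rV_compact R n (fun=> `[0, 1]%classic)) => _; exact: segment_compact.
rewrite lt_neqAle Vol_ge0 andbT eq_sym; apply/eqP => Q0.
have h0 : 0 < 1 / 2 :> R by [].
have [|F [cF QF]] := Vol_cover_open (A := Q) h0; first by rewrite Q0 ltry.
rewrite Q0 add0e => F2.
have := cQ; rewrite compact_cover => /(_ _ F (fun B => (box B)°)).
case=> [B _|//|D DF QD]; first exact: open_interior.
have : 1 <= \sum_(B <- enum_fset D) box_vol B.
  apply: cube_cover_vol => x Qx; have [B BD Bx] := QD x Qx.
  by exists B => //; exact: interior_subset.
suff D2 : (\sum_(B <- enum_fset D) (box_vol B)%:E <= (1 / 2 : R)%:E)%E.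
  by move: D2; rewrite sumEFin lee_fin; lra.
apply: le_trans F2; rewrite fsbig_seq ?fset_uniq//.
apply: ereal_sup_ubound; exists [set` D] => //.
by split => // B /DF/set_mem.
Qed.

(** An open set contains a small cube, a dilation of which is the unit cube. *)
Lemma Vol_open_gt0 U : open U -> U !=set0 -> (0 < Vol U)%E.
Proof.
move=> oU [x Ux]; have /nbhs_ballP[e /= e0 xeU] : nbhs x U by exact: open_nbhs_nbhs.
rewrite lt_neqAle Vol_ge0 andbT eq_sym; apply/eqP => U0.
have e2 : 0 < (e / 2)^-1 by rewrite invr_gt0 divr_gt0.
suff : (Vol [set y : E | forall i, (0 <= y 0 i <= 1)%R] <= 0)%E.
  by rewrite leNgt Vol_cube_gt0.
apply: (@le_trans _ _ (((e / 2)^-1 ^+ n)%:E * Vol U)%E); last by rewrite U0 mule0.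
apply: le_trans (Vol_affine_le U (- ((e / 2)^-1 *: x)) e2); apply: Vol_le => y Qy.
exists ((e / 2) *: y + x); last first.
  by rewrite scalerDr scalerA mulVf ?scale1r ?addrK// gt_eqF// divr_gt0.
apply: xeU; split => // i j; rewrite ord1 /ball/= !mxE.
have /andP[y0 y1] := Qy j.
rewrite opprD addrCA subrr addr0 normrN ger0_norm ?mulr_ge0//; nra.
Qed.



(** The bundled form from which the measure structure on measurable sets is
    inferred. *)
Definition Vol_outer : {outer_measure set E -> \bar R} := @Vol R n.

Lemma Vol_fin_bigcup (I : choiceType) (D : set I) (F : I -> set E) :
  finite_set D -> trivIset D F -> (forall i, D i -> lebesgue_measurable (F i)) ->
  Vol (\bigcup_(i in D) F i) = (\sum_(i \in D) Vol (F i))%E.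
Proof.
exact: (measure_fin_bigcup (Vol_outer : set (caratheodory_type Vol_outer) -> _)).
Qed.

Lemma Vol_split A (X : set E) : lebesgue_measurable A ->
  Vol X = (Vol (X `&` A) + Vol (X `\` A))%E.
Proof. by move=> /(_ X); rewrite setDE. Qed.

Lemma Vol_translate A (v : E) : Vol [set x + v | x in A] = Vol A.
Proof.
have leV (A' : set E) w : (Vol [set (x + w)%R | x in A'] <= Vol A')%E.
  have := Vol_affine_le A' w (@ltr01 R); rewrite expr1n mul1e.
  by apply: le_trans; apply: Vol_le => _ [x Ax <-]; exists x; rewrite ?scale1r.
apply/eqP; rewrite eq_le leV /=; apply: le_trans (leV _ (- v)).
by apply: Vol_le => x Ax; exists (x + v); [exists x|rewrite addrK].
Qed.

Lemma Vol_null_affine N (a : R) (v : E) : 0 < a -> Vol N = 0%E ->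
  Vol [set a *: x + v | x in N] = 0%E.
Proof.
move=> a0 N0; apply/eqP; rewrite eq_le Vol_ge0 andbT.
by rewrite (le_trans (Vol_affine_le _ _ a0))// N0 mule0.
Qed.

Lemma compact_translate (K : set E) (v : E) : compact K ->
  compact [set x + v | x in K].
Proof.
move=> cK; have ctr : {within K, continuous (fun x : E => x + v)}.
  apply: continuous_subspaceT => x.
  by apply: (cvgD cvg_id (cvg_cst v)).
exact: (continuous_compact ctr cK).
Qed.

(** The translates of [K] by the vectors [v / j.+1] are pairwise disjoint and stay in
    a bounded set, which cannot contain infinitely many sets of the same positive
    volume. *)
Lemma Vol0_of_transverse (K : set E) (v : E) : compact K ->
  (forall p t, 0 < t -> K p -> ~ K (p + t *: v)) -> Vol K = 0%E.
Proof.
move=> cK Kv; pose F j := [set p + j.+1%:R^-1 *: v | p in K].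
have mF j : lebesgue_measurable (F j) by apply/measurable_compact/compact_translate.
have tF : trivIset setT F.
  have sep i j p q : (i < j)%N -> K p -> K q ->
      p + i.+1%:R^-1 *: v = q + j.+1%:R^-1 *: v -> False.
    move=> ij Kp Kq pq.
    apply: (Kv p (i.+1%:R^-1 - j.+1%:R^-1)) => //.
      by rewrite subr_gt0 ltf_pV2 ?posrE// ltr_nat ltnS.
    by rewrite scalerBl addrA pq addrK.
  move=> i j _ _ [_ [[p Kp <-] [q Kq qp]]].
  by case: (ltngtP i j) => // ij; [case: (sep i j p q)|case: (sep j i q p)].
have bU : bounded_set (\bigcup_j F j).
  have /ex_strict_bound_gt0[M M0 KM] := compact_bounded cK.
  exists (M + `|v|); split; first exact: num_real.
  move=> N /ltW MN _ [j _ [p /KM pM <-]] /=; apply: le_trans MN.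
  apply: le_trans (ler_normD _ _) _; apply: lerD; first exact: ltW.
  by rewrite normrZ ger0_norm// ler_piMl// invf_le1// ler1n.
have finU := Vol_bounded bU.
have VK : Vol K = (fine (Vol K))%:E by rewrite fineK// ge0_fin_numE ?Vol_compact.
apply/eqP; rewrite eq_le Vol_ge0 andbT leNgt; apply/negP => K0.
have c0 : 0 < fine (Vol K) by rewrite -lte_fin -VK.
have VU : Vol (\bigcup_j F j) = (fine (Vol (\bigcup_j F j)))%:E.
  by rewrite fineK// ge0_fin_numE.
have mc m : (m%:R * fine (Vol K) <= fine (Vol (\bigcup_j F j))).
  rewrite -lee_fin -VU.
  apply: (@le_trans _ _ (Vol (\bigcup_(j in `I_m) F j))); last first.
    by apply: Vol_le => x [j _ Fj]; exists j.
  rewrite Vol_fin_bigcup//; last exact: sub_trivIset tF.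
  rewrite (eq_fsbigr (fun=> Vol K)); last by move=> j _; exact: Vol_translate.
  rewrite -(fsbig_ord _ _ (fun=> Vol K)) VK sumEFin.
  by rewrite lee_fin sumr_const card_ord mulr_natl.
have := mc (Num.truncn (fine (Vol (\bigcup_j F j)) / fine (Vol K))).+1.
rewrite leNgt -ltr_pdivrMr// => /negP; apply.
exact: truncnS_gt.
Qed.


End Volume.

(** * The scalar product *)

Section DotProduct.
Context {R : realType} {n : nat}.
Local Notation E := 'rV[R]_n.
Implicit Types (x y p q : E).

Lemma dotvC x y : dotv x y = dotv y x.
Proof. by apply: eq_bigr => i _; rewrite mulrC. Qed.

Lemma dotvDl x y z : dotv (x + y) z = dotv x z + dotv y z.
Proof. by rewrite -big_split; apply: eq_bigr => i _; rewrite mxE mulrDl. Qed.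

Lemma dotvZl a x y : dotv (a *: x) y = a * dotv x y.
Proof. by rewrite mulr_sumr; apply: eq_bigr => i _; rewrite mxE mulrA. Qed.

Lemma dotvNl x y : dotv (- x) y = - dotv x y.
Proof. by rewrite -scaleN1r dotvZl mulN1r. Qed.

Lemma dotvBl x y z : dotv (x - y) z = dotv x z - dotv y z.
Proof. by rewrite dotvDl dotvNl. Qed.

Lemma dotvDr x y z : dotv x (y + z) = dotv x y + dotv x z.
Proof. by rewrite !(dotvC x) dotvDl. Qed.

Lemma dotvZr a x y : dotv x (a *: y) = a * dotv x y.
Proof. by rewrite !(dotvC x) dotvZl. Qed.

Lemma dotvNr x y : dotv x (- y) = - dotv x y.
Proof. by rewrite !(dotvC x) dotvNl. Qed.

Lemma dotvBr x y z : dotv x (y - z) = dotv x y - dotv x z.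
Proof. by rewrite dotvDr dotvNr. Qed.

Lemma dotv0l x : dotv 0 x = 0.
Proof. by rewrite -(scale0r (0 : E)) dotvZl mul0r. Qed.

Lemma dotv0r x : dotv x 0 = 0.
Proof. by rewrite dotvC dotv0l. Qed.

Definition dotvE := (dotvDl, dotvDr, dotvZl, dotvZr, dotvNl, dotvNr, dotv0l, dotv0r).

Lemma dotv_subZ_sqr (t : R) x y : dotv (t *: x - y) (t *: x - y) =
  t ^+ 2 * dotv x x - t * dotv x y *+ 2 + dotv y y.
Proof. rewrite !dotvE (dotvC y x); ring. Qed.

Lemma dotv_delta x (i : 'I_n) : dotv x (delta_mx 0 i) = x 0 i.
Proof.
rewrite /dotv (bigD1 i)//= big1 ?addr0 ?mxE ?eqxx ?mulr1// => j ji.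
by rewrite mxE (negbTE ji) mulr0.
Qed.

Lemma dotv_ge0 x : 0 <= dotv x x.
Proof. by apply: sumr_ge0 => i _; rewrite -expr2 sqr_ge0. Qed.

Lemma dotv_sqr_coord x i : x 0 i ^+ 2 <= dotv x x.
Proof.
rewrite /dotv (bigD1 i)//= -expr2 lerDl.
by apply: sumr_ge0 => j _; rewrite -expr2 sqr_ge0.
Qed.

Lemma dotv_eq0 x : (dotv x x == 0) = (x == 0).
Proof.
apply/eqP/eqP => [x0|->]; last exact: dotv0l.
apply/rowP => i; rewrite mxE; apply/eqP; rewrite -sqrf_eq0 eq_le sqr_ge0 andbT.
by rewrite -x0 dotv_sqr_coord.
Qed.

Lemma dotv_le_norm x y : `|dotv x y| <= n%:R * (`|x| * `|y|).
Proof.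
apply: le_trans (ler_norm_sum _ _ _) _.
rewrite -[n in n%:R]card_ord mulr_natl -sumr_const; apply: ler_sum => i _.
by rewrite normrM ler_pM// coord_le_norm.
Qed.

Lemma norm_sqr_le_dotv x : `|x| ^+ 2 <= dotv x x.
Proof.
have s0 : 0 <= Num.sqrt (dotv x x) by exact: sqrtr_ge0.
rewrite -[leRHS]sqr_sqrtr ?dotv_ge0// ler_sqr ?nnegrE//.
apply: norm_le_coord => // i; rewrite -sqrtr_sqr ler_wsqrtr//.
exact: dotv_sqr_coord.
Qed.

Lemma dotv_cvg (T : Type) (F : set_system T) (f g : T -> E) x y : Filter F ->
  f t @[t --> F] --> x -> g t @[t --> F] --> y ->
  dotv (f t) (g t) @[t --> F] --> dotv x y.
Proof.
move=> FF fx gy.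
have coord (h : T -> E) (z : E) i : h t @[t --> F] --> z -> h t 0 i @[t --> F] --> z 0 i.
  by move=> hz; exact: (cvg_comp _ (fun v : E => v 0 i) hz (@coord_continuous R 1 n 0 i z)).
rewrite /dotv; apply: cvg_big => [|i _].
  exact: add_continuous.
by apply: cvgM; exact: coord.
Qed.

End DotProduct.

(** * Support functions and linear growth *)

Section SupportFunction.
Context {R : realType} {n : nat}.
Local Notation E := 'rV[R]_n.
Variable P : set E.
Hypotheses (cP : compact P) (P0 : P !=set0).
Implicit Types (x y z p q : E) (h : E -> R).
Local Notation hP := (support_function P).

Lemma dotv_image_ubound x : has_ubound [set dotv x p | p in P].
Proof.
have /ex_strict_bound_gt0[M M0 PM] := compact_bounded cP.
exists (n%:R * (`|x| * M)) => _ [p /PM pM <-].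
apply: le_trans (ler_norm _) _; apply: le_trans (dotv_le_norm _ _) _.
by rewrite ler_wpM2l// ler_wpM2l// ltW.
Qed.

Lemma dotv_le_support x p : P p -> dotv p x <= hP x.
Proof.
move=> Pp; apply: ub_le_sup; first exact: dotv_image_ubound.
by exists p => //; rewrite dotvC.
Qed.

Lemma support_le x (c : R) : (forall p, P p -> dotv p x <= c) -> hP x <= c.
Proof.
move=> Pc; apply: ge_sup; first exact: image_nonempty.
by move=> _ [p Pp <-]; rewrite dotvC Pc.
Qed.

Lemma support0 : hP 0 = 0.
Proof.
apply/eqP; rewrite eq_le; apply/andP; split.
  by apply: support_le => p _; rewrite dotv0r.
by have [p Pp] := P0; rewrite -(dotv0r p) dotv_le_support.
Qed.

Lemma support_subadd x y : hP (x + y) <= hP x + hP y.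
Proof.
by apply: support_le => p Pp; rewrite dotvDr lerD// dotv_le_support.
Qed.

Lemma support_homog (t : R) x : 0 <= t -> hP (t *: x) <= t * hP x.
Proof.
by move=> t0; apply: support_le => p Pp; rewrite dotvZr ler_wpM2l// dotv_le_support.
Qed.

Lemma support_bound : exists2 M, 0 < M & forall x, hP x <= M * `|x|.
Proof.
have /ex_strict_bound_gt0[M M0 PM] := compact_bounded cP.
exists (n%:R * M + 1) => [|x]; first by rewrite ltr_wpDl// mulr_ge0// ltW.
apply: support_le => p /PM pM; apply: le_trans (ler_norm _) _.
apply: le_trans (dotv_le_norm _ _) _; rewrite mulrA ler_wpM2r//.
by apply: (@le_trans _ _ (n%:R * M)); rewrite ?lerDl// ler_wpM2l// ltW.
Qed.

Lemma convex_set_segment p q (t : R) : convex_set (P : set (convex_lmodType E)) ->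
  P p -> P q -> 0 <= t <= 1 -> P (p + t *: (q - p)).
Proof.
move=> vP Pp Pq /andP[t0 t1].
have -> : p + t *: (q - p) = t *: q + (1 - t) *: p.
  by rewrite scalerBl scale1r scalerBr addrCA.
exact: (set_mem (vP _ _ (Itv01 t0 t1) (mem_set Pq) (mem_set Pp))).
Qed.

(** With the Euclidean projection [p] of [q] onto [P], the direction [q - p]
    separates [q] from [P] unless [q = p]. *)
Lemma support_separation q : convex_set (P : set (convex_lmodType E)) ->
  (forall x, dotv q x <= hP x) -> P q.
Proof.
move=> vP qP.
have cf : {within P, continuous (fun p => dotv (p - q) (p - q))}.
  apply: continuous_subspaceT => x.
  have cx : (fun p : E => p - q) p @[p --> x] --> x - q.
    by apply: (cvgD cvg_id (cvg_cst (- q))).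
  exact: (@dotv_cvg R n E (nbhs x) (fun p => p - q) (fun p => p - q) _ _ _ cx cx).
have [p /set_mem Pp pmin] := EVT_min_rV P0 cP cf.
suff pq : dotv (q - p) (q - p) <= 0.
  have : q - p == 0 by rewrite -dotv_eq0 eq_le pq dotv_ge0.
  by rewrite subr_eq0 => /eqP ->.
have obtuse p' : P p' -> dotv p' (q - p) <= dotv p (q - p).
  move=> Pp'; rewrite -subr_le0 -dotvBl leNgt; apply/negP => d0.
  pose N := dotv (p' - p) (p' - p).
  have N0 : 0 <= N by exact: dotv_ge0.
  pose t := Num.min 1 (dotv (p' - p) (q - p) / (N + 1)).
  have t0 : 0 < t by rewrite lt_min ltr01 divr_gt0// ltr_wpDl.
  have t1 : t <= 1 by rewrite ge_min lexx.
  have Pt : P (p + t *: (p' - p)).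
    by apply: convex_set_segment => //; rewrite (ltW t0) t1.
  have := pmin _ (mem_set Pt).
  rewrite leNgt => /negP; apply.
  have -> : p + t *: (p' - p) - q = t *: (p' - p) - (q - p).
    by rewrite opprB addrCA addrA (addrC p).
  have -> : p - q = - (q - p) by rewrite opprB.
  rewrite dotv_subZ_sqr dotvNl dotvNr opprK.
  have tN : t * (N + 1) <= dotv (p' - p) (q - p).
    by rewrite -ler_pdivlMr ?ltr_wpDl// ge_min lexx orbT.
  rewrite -/N; move: (dotv _ _) d0 tN => d d0 tN; nra.
by have := le_trans (qP (q - p)) (support_le obtuse); rewrite -subr_le0 -dotvBl.
Qed.

(** For convex functions this is the growth condition [h <= h_P + C], in a form that
    is preserved by pointwise limits. *)
Definition support_lipschitz h := forall x y, h y - h x <= hP (y - x).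

Lemma support_lipschitz_support : support_lipschitz hP.
Proof. by move=> x y; rewrite lerBlDr -{1}(subrK x y) support_subadd. Qed.

Lemma support_lipschitz_norm : exists2 M, 0 < M &
  forall h, support_lipschitz h -> forall x y, `|h y - h x| <= M * `|y - x|.
Proof.
have [M M0 hM] := support_bound; exists M => // h hh x y; rewrite ler_norml.
apply/andP; split; last exact: le_trans (hh _ _) (hM _).
by rewrite lerNl opprB distrC; exact: le_trans (hh _ _) (hM _).
Qed.

Lemma support_lipschitz_continuous h : support_lipschitz h -> continuous h.
Proof.
move=> hh; have [M M0 hM] := support_lipschitz_norm.
move=> x; apply/(@cvgrPdist_lt R R E (nbhs x) (nbhs_filter x)) => e e0.
near=> y.
rewrite distrC; apply: le_lt_trans (hM _ hh _ _) _.
rewrite -ltr_pdivlMl// distrC; near: y.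
by have := @nbhsx_ballx R E x (M^-1 * e) (mulr_gt0 _ e0); rewrite -ball_normE;
  apply; rewrite invr_gt0.
Unshelve. all: by end_near. Qed.

Lemma convex_on_rVP h : convex_on_rV h <->
  forall (t : R) x y, 0 <= t <= 1 ->
    h (t *: x + (1 - t) *: y) <= t * h x + (1 - t) * h y.
Proof.
split => [hc t x y /andP[t0 t1]|hc t x y _ _].
  by have := hc (Itv01 t0 t1) x y (mem_set Logic.I) (mem_set Logic.I).
by apply: hc; rewrite ge0 le1.
Qed.

(** By convexity the slope of [h] from [x] towards [y] is at most its slope at
    infinity, which the growth condition bounds by [h_P (y - x)]. *)
Lemma class_L_lipschitz h : class_L P h -> support_lipschitz h.
Proof.
move=> [/convex_on_rVP hc [C hC]] x y.
rewrite leNgt -subr_gt0; apply/negP; set d := _ - _ => d0.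
pose K := hP x + C - h x.
have tK t : 1 <= t -> t * d <= K.
  move=> t1; have t0 : 0 < t by apply: lt_le_trans t1.
  have := hc t^-1 (x + t *: (y - x)) x.
  rewrite invr_ge0 (ltW t0) invf_le1// t1 => /(_ isT).
  have -> : t^-1 *: (x + t *: (y - x)) + (1 - t^-1) *: x = y.
    rewrite scalerDr scalerA mulVf ?gt_eqF// scale1r scalerBl scale1r.
    by rewrite addrC addrA subrK addrC subrK.
  move=> hy; have : t * h y <= h (x + t *: (y - x)) + (t - 1) * h x.
    have -> : h (x + t *: (y - x)) + (t - 1) * h x =
        t * (t^-1 * h (x + t *: (y - x)) + (1 - t^-1) * h x).
      by field; rewrite gt_eqF.
    by rewrite ler_pM2l.
  have := hC (x + t *: (y - x)); have := support_subadd x (t *: (y - x)).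
  have := support_homog (y - x) (ltW t0).
  rewrite /d /K; nra.
have := tK (`|K| / d + 1); rewrite lerDr divr_ge0 ?(ltW d0)// => /(_ isT).
rewrite mulrDl divfK ?gt_eqF// mul1r; have := ler_norm K; lra.
Qed.

Lemma lipschitz_class_L h : convex_on_rV h -> support_lipschitz h -> class_L P h.
Proof.
move=> hc hh; split => //; exists (h 0) => x.
by have := hh 0 x; rewrite subr0 lerBlDr.
Qed.

Lemma subgradient_lipschitz_sub h x : convex_set (P : set (convex_lmodType E)) ->
  support_lipschitz h -> subgradient h x `<=` P.
Proof.
move=> vP hh q hq; apply: support_separation => // y.
have := hq (y + x); rewrite addrK -lerBrDl => /le_trans; apply.
by have := hh x (y + x); rewrite addrK.
Qed.

Lemma subgradient_image_sub h (A : set E) :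
  convex_set (P : set (convex_lmodType E)) -> support_lipschitz h ->
  subgradient_image h A `<=` P.
Proof. by move=> vP hh p [x _ /(subgradient_lipschitz_sub vP hh)]. Qed.

(** Every point of [P] is a subgradient of the support function at 0. *)
Lemma subgradient_image_support : convex_set (P : set (convex_lmodType E)) ->
  subgradient_image hP setT = P.
Proof.
move=> vP; apply/seteqP; split.
  exact: subgradient_image_sub vP support_lipschitz_support.
move=> p Pp; exists 0 => // y.
by rewrite support0 add0r subr0 dotv_le_support.
Qed.

End SupportFunction.

(** * Semicontinuity of volumes and of subgradient images *)

Section UpperSemicontinuity.
Context {R : realType} {n : nat}.
Local Notation E := 'rV[R]_n.
Variable P : set E.
Hypotheses (cP : compact P) (P0 : P !=set0).
Hypothesis vP : convex_set (P : set (convex_lmodType E)).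
Implicit Types (x y z p q : E) (h : E -> R).

(** Volume is upper semicontinuous along a family of subsets of a fixed compact
    set whose graph is closed: outer regularity puts the limit set in an open set
    of small volume, and compactness traps the nearby sets in it. *)
Lemma Vol_usc (I : Type) (F : set_system I) (C : I -> set E) (C0 : set E) (c : R) :
  Filter F -> (forall i, C i `<=` P) ->
  (forall p, P p -> ~ C0 p -> \forall q \near p & i \near F, ~ C i q) ->
  (Vol C0 < c%:E)%E -> \forall i \near F, (Vol (C i) < c%:E)%E.
Proof.
move=> FF CP Cp /Vol_outer_regular[U [oU CU Uc]].
have cPU : compact (P `\` U).
  rewrite setDE; apply: (subclosed_compact _ cP); last exact: subIsetl.
  by apply: closedI; [exact: compact_closed_rV|exact: open_closedC].
move/compact_near_coveringP : cPU => /(_ _ F (fun i q => ~ C i q)) cov.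
have /cov : forall x, (P `\` U) x -> \forall q \near x & i \near F, ~ C i q.
  by move=> p [Pp Up]; apply: Cp => // /CU.
apply: filterS => i PUi; apply: le_lt_trans Uc; apply: Vol_le => q Cq.
by apply: contrapT => Uq; exact: PUi (conj (CP _ _ Cq) Uq) Cq.
Qed.

(** If [p] is not a subgradient of [h] at [x], the inequality that it violates is
    still violated near [p] and [x] by all nearby functions, since these have a
    common Lipschitz constant; the compactness of [K] makes this uniform in [x]. *)
Lemma subgradient_image_near (I : Type) (F : set_system I) (g : I -> E -> R)
    h (K : set E) p :
  Filter F -> (forall i, support_lipschitz P (g i)) ->
  (forall x, g i x @[i --> F] --> h x) -> compact K ->
  ~ subgradient_image h K p ->
  \forall q \near p & i \near F, ~ subgradient_image (g i) K q.
Proof.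
move=> FF gl gh /compact_near_coveringP cK hp.
have /cK : forall x, K x -> \forall x' \near x &
    qi \near filter_prod (nbhs p) F, ~ subgradient (g qi.2) x' qi.1.
  move=> x Kx.
  have [y hy] : exists y, h y < h x + dotv p (y - x).
    apply: contrapT => /forallNP hN; apply: hp; exists x => // y.
    by rewrite leNgt; apply/negP/hN.
  have [M M0 gM] := support_lipschitz_norm cP P0.
  pose u (w : E * (E * I)) := g w.2.2 x - M * `|w.1 - x| + dotv w.2.1 (y - w.1).
  pose G := filter_prod (nbhs x) (filter_prod (nbhs p) F).
  have FG : Filter G by exact: filter_prod_filter.
  have c12 : w.2 @[w --> G] --> filter_prod (nbhs p) F by exact: cvg_snd.
  have c2 : w.2.1 @[w --> G] --> p by exact: (cvg_comp _ fst c12 cvg_fst).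
  have c3 : w.2.2 @[w --> G] --> F by exact: (cvg_comp _ snd c12 cvg_snd).
  have cu : u w @[w --> G] --> h x - M * `|x - x| + dotv p (y - x).
    have c1 : w.1 @[w --> G] --> x by exact: cvg_fst.
    have cn : `|w.1 - x| @[w --> G] --> `|x - x|.
      by exact: (cvg_norm (cvgB c1 (cvg_cst x))).
    have cd : dotv w.2.1 (y - w.1) @[w --> G] --> dotv p (y - x).
      exact: dotv_cvg c2 (cvgB (cvg_cst y) c1).
    have cg : g w.2.2 x @[w --> G] --> h x.
      exact: (cvg_comp _ (fun i => g i x) c3 (gh x)).
    exact: (cvgD (cvgB cg (cvgM (cvg_cst M) cn)) cd).
  have cy : g w.2.2 y @[w --> G] --> h y.
    by exact: (cvg_comp _ (fun i => g i y) c3 (gh y)).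
  rewrite subrr normr0 mulr0 subr0 in cu.
  have : \forall w \near G, 0 < u w - g w.2.2 y.
    have pos : 0 < h x + dotv p (y - x) - h y by rewrite subr_gt0.
    have cuy := cvgB cu cy.
    by have /cuy := lt_nbhsr pos.
  apply: filterS => -[x' [q i]] /=; rewrite subr_gt0 /u /= => uy /(_ y).
  rewrite leNgt => /negP; apply; apply: lt_le_trans uy _.
  by rewrite lerD2r; have := gM _ (gl i) x x'; rewrite ler_norml => /andP[]; lra.
apply: filterS => -[q i] Kq [x Kx xq]; exact: Kq x Kx xq.
Qed.

Lemma subgradient_image_compact h (K : set E) : support_lipschitz P h ->
  compact K -> compact (subgradient_image h K).
Proof.
move=> hl cK; apply: (subclosed_compact _ cP); last first.
  exact: subgradient_image_sub.
rewrite -[X in closed X]setCK; apply: open_closedC.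
rewrite openE => p hp.
have [[U V] [/= pU FV] UV] := @subgradient_image_near nat \oo (fun=> h) h K p
  _ (fun=> hl) (fun x => cvg_cst _) cK hp.
have [i Vi] := filter_ex FV.
by apply: filterS pU => q Uq; exact: (UV (q, i)).
Qed.



Lemma subgradient_image_usc (I : Type) (F : set_system I) (g : I -> E -> R) h
    (K : set E) (c : R) : Filter F -> (forall i, support_lipschitz P (g i)) ->
  (forall x, g i x @[i --> F] --> h x) -> compact K ->
  (Vol (subgradient_image h K) < c%:E)%E ->
  \forall i \near F, (Vol (subgradient_image (g i) K) < c%:E)%E.
Proof.
move=> FF gl gh cK; apply: Vol_usc => [i|p Pp hp].
  exact: subgradient_image_sub.
exact: subgradient_image_near hp.
Qed.

Lemma measurable_subgradient_compact h (K : set E) : support_lipschitz P h ->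
  compact K -> lebesgue_measurable (subgradient_image h K).
Proof. by move=> hl cK; apply/measurable_compact/subgradient_image_compact. Qed.

Definition multi_subgradient h : set E :=
  [set p | exists x y, [/\ x != y, subgradient h x p & subgradient h y p]].

(** The subdifferential of [h] is a monotone relation. *)
Lemma subgradient_monotone h x y p q : subgradient h x p -> subgradient h y q ->
  0 <= dotv (p - q) (x - y).
Proof.
move=> /(_ y) hp /(_ x) hq; rewrite dotvBl subr_ge0.
have -> : x - y = - (y - x) by rewrite opprB.
rewrite !dotvNr; move: hp hq.
have -> : x - y = - (y - x) by rewrite opprB.
rewrite dotvNr; lra.
Qed.

Lemma compact_ballI (r : R) (C : set E) : closed C ->
  compact [set x : E | `|x| <= r /\ C x].
Proof.
move=> cC; apply: bounded_closed_compact.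
  exists r; split; first exact: num_real.
  by move=> N /ltW rN x [xr _] /=; exact: le_trans xr rN.
have cB : closed [set x : E | `|x| <= r].
  exact: (@preimage_closed E R (fun x => `|x|) [set t | t <= r]
    (fun x _ => @norm_continuous R E x) (@closed_le R r)).
exact: closedI cB cC.
Qed.

Lemma closed_coord_le (i : 'I_n) (a : R) : closed [set x : E | x 0 i <= a].
Proof.
exact: (@preimage_closed E R (fun x => x 0 i) [set t | t <= a]
  (fun x _ => @coord_continuous R 1 n 0 i x) (@closed_le R a)).
Qed.

Lemma closed_coord_ge (i : 'I_n) (a : R) : closed [set x : E | a <= x 0 i].
Proof.
exact: (@preimage_closed E R (fun x => x 0 i) [set t | a <= t]
  (fun x _ => @coord_continuous R 1 n 0 i x) (@closed_ge R a)).
Qed.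

(** The points where the convex conjugate of [h] is not differentiable. If two
    points of its subdifferential at [p] are separated by a slab [a < b] in the
    [i]-th coordinate, then by monotonicity this happens for at most one [p] on
    each line in the [i]-th direction. *)
Lemma Vol_multi_subgradient h : support_lipschitz P h ->
  Vol (multi_subgradient h) = 0%E.
Proof.
move=> hl.
pose K1 (s : 'I_n * (rat * rat) * nat) : set E :=
  [set x | (`|x| <= s.2%:R)%R /\ [set x : E | x 0 s.1.1 <= ratr s.1.2.1] x].
pose K2 (s : 'I_n * (rat * rat) * nat) : set E :=
  [set x | (`|x| <= s.2%:R)%R /\ [set x : E | ratr s.1.2.2 <= x 0 s.1.1] x].
pose D s := subgradient_image h (K1 s) `&` subgradient_image h (K2 s).
apply: (@Vol_null_sub _ _ _
    (\bigcup_(s in [set s | ratr s.1.2.1 < ratr s.1.2.2 :> R]) D s)).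
  move=> p [x [y [xy px py]]].
  wlog [i xyi] : x y xy px py / exists i, x 0 i < y 0 i.
    move=> wl; have [i xyi] : exists i, x 0 i != y 0 i.
      apply: contrapT => /forallNP xyN; move/eqP : xy; apply; apply/rowP => i.
      by apply/eqP; apply: contrapT => /negP; exact: xyN.
    have [lt|gt|/eqP] := ltgtP (x 0 i) (y 0 i); last by rewrite (negbTE xyi).
      by apply: (wl x y) => //; exists i.
    by apply: (wl y x) => //; [rewrite eq_sym|exists i].
  have [a /[!in_itv]/= /andP[xa ay]] := rat_in_itvoo xyi.
  have [b /[!in_itv]/= /andP[ab by_]] := rat_in_itvoo ay.
  pose k := (Num.truncn (`|x| + `|y|)).+1.
  have xyk : `|x| + `|y| < k%:R by exact: truncnS_gt.
  exists (i, (a, b), k) => //=; split.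
    exists x => //; split; last exact: ltW.
    by rewrite ltW// (le_lt_trans _ xyk)// lerDl.
  exists y => //; split; last exact: ltW.
  by rewrite ltW// (le_lt_trans _ xyk)// lerDr.
apply: Vol_null_bigcup => -[[i [a b]] k] /= ab.
have cD : compact (D (i, (a, b), k)).
  apply: compact_closedI; last first.
    apply: compact_closed_rV; apply: subgradient_image_compact => //.
    by apply: compact_ballI; exact: closed_coord_ge.
  apply: subgradient_image_compact => //.
  by apply: compact_ballI; exact: closed_coord_le.
apply: (Vol0_of_transverse (v := delta_mx 0 i) cD).
move=> p t t0 [_ [y [_ /= yb] py]] [[x [_ /= xa] px] _].
have := subgradient_monotone px py.
rewrite addrAC subrr add0r dotvZl dotvC dotv_delta !mxE pmulr_rge0//.
move: ab yb xa; lra.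
Qed.

End UpperSemicontinuity.

(** * The volume of subgradient images as a Borel measure *)

Section SubgradientMeasure.
Context {R : realType} {n : nat}.
Local Notation E := 'rV[R]_n.
Local Notation borelE := (borel_rV R n).

Lemma borel_open (U : set E) : open U -> measurable (U : set borelE).
Proof. exact: sub_sigma_algebra. Qed.

Lemma borel_closed (C : set E) : closed C -> measurable (C : set borelE).
Proof. by rewrite -openC -{2}(setCK C) => /borel_open; exact: measurableC. Qed.

Lemma closed_compact_bigcup (C : set E) : closed C ->
  exists K : nat -> set E, [/\ forall k, compact (K k),
    nondecreasing_seq K & C = \bigcup_k K k].
Proof.
move=> cC; exists (fun k => [set x : E | `|x| <= k%:R /\ C x]); split.
- by move=> k; exact: compact_ballI.
- move=> k l kl; apply/subsetPset => x [xk Cx]; split => //.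
  by rewrite (le_trans xk)// ler_nat.
- apply/seteqP; split => [x Cx|x [k _ []//]].
  exists (Num.truncn `|x|).+1 => //; split => //.
  by rewrite ltW// truncnS_gt.
Qed.

Lemma open_compact_bigcup (U : set E) : open U ->
  exists K : nat -> set E, [/\ forall k, compact (K k),
    nondecreasing_seq K & U = \bigcup_k K k].
Proof.
move=> oU.
pose far (r : R) : set E := \bigcap_(y in ~` U) [set x | r <= `|x - y|].
have cfar r : closed (far r).
  apply: closed_bigI => y _.
  apply: (@preimage_closed E R (fun x => `|x - y|) [set t | r <= t]); last first.
    exact: closed_ge.
  move=> x _; have cx : z - y @[z --> x] --> x - y.
    by apply: (cvgB cvg_id (cvg_cst y)).
  exact: (cvg_norm cx).
exists (fun k => [set x : E | `|x| <= k%:R /\ far k.+1%:R^-1 x]); split.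
- by move=> k; exact: compact_ballI.
- move=> k l kl; apply/subsetPset => x [xk fx]; split.
    by rewrite (le_trans xk)// ler_nat.
  move=> y Uy; apply: le_trans (fx y Uy).
  by rewrite lef_pV2 ?posrE// ler_nat ltnS.
- apply/seteqP; split => [x Ux|x [k _ [_ fx]]]; last first.
    apply: contrapT => Ux; have := fx x Ux.
    by rewrite /= subrr normr0 leNgt invr_gt0 ltr0n.
  have /nbhs_ballP[e /= e0] : nbhs x U by exact: open_nbhs_nbhs.
  rewrite -ball_normE => xeU.
  have [N] := ltr_add_invr e0; rewrite add0r => Ne.
  pose k := maxn N (Num.truncn `|x|).+1.
  exists k => //; split.
    apply: (@le_trans _ _ (Num.truncn `|x|).+1%:R); first by rewrite ltW// truncnS_gt.
    by rewrite ler_nat leq_maxr.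
  move=> y Uy /=; rewrite leNgt; apply/negP => xy; apply: Uy; apply: xeU => /=.
  apply: lt_trans xy _; apply: le_lt_trans Ne.
  by rewrite lef_pV2 ?posrE// ler_nat ltnS leq_maxl.
Qed.

Lemma subgradient_image_bigcup (h : E -> R) (I : Type) (D : set I) (A : I -> set E) :
  subgradient_image h (\bigcup_(i in D) A i) =
  \bigcup_(i in D) subgradient_image h (A i).
Proof.
apply/seteqP; split => [p [x [i Di Ax] px]|p [i Di [x Ax px]]].
  by exists i => //; exists x.
by exists x => //; exists i.
Qed.

Lemma subgradient_image_subset (h : E -> R) (A B : set E) : A `<=` B ->
  subgradient_image h A `<=` subgradient_image h B.
Proof. by move=> AB p [x /AB Bx px]; exists x. Qed.

Lemma subgradient_image_disjoint (h : E -> R) (A B : set E) :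
  A `&` B = set0 ->
  subgradient_image h A `&` subgradient_image h B `<=` multi_subgradient h.
Proof.
move=> AB p [[x Ax px] [y By py]]; exists x, y; split => //.
apply/eqP => xy; suff : (A `&` B) x by rewrite AB.
by split; rewrite // xy.
Qed.

Lemma Vol_setD_null (A N : set E) : Vol N = 0%E -> Vol (A `\` N) = Vol A.
Proof.
move=> N0; apply/eqP; rewrite eq_le Vol_le//=.
apply: (@le_trans _ _ (Vol ((A `\` N) `|` N))).
  by apply: Vol_le => x Ax; have [Nx|Nx] := pselect (N x); [right|left].
by rewrite (le_trans (Vol_setU _ _))// N0 adde0.
Qed.

Variable P : set E.
Hypotheses (cP : compact P) (P0 : P !=set0).
Hypothesis vP : convex_set (P : set (convex_lmodType E)).
Variable h : E -> R.
Hypothesis hl : support_lipschitz P h.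

Lemma measurable_subgradient_open (U : set E) : open U ->
  lebesgue_measurable (subgradient_image h U).
Proof.
move=> /open_compact_bigcup[K [cK _ ->]]; rewrite subgradient_image_bigcup.
by apply: bigcupT_measurable => k; exact: (measurable_subgradient_compact cP).
Qed.

(** Images of a set and of its complement overlap in a null set only, so that the
    sets with a measurable image form a sigma-algebra. *)
Lemma measurable_subgradient_image (A : set borelE) : measurable A ->
  lebesgue_measurable (subgradient_image h A).
Proof.
pose G : set (set E) := [set A | lebesgue_measurable (subgradient_image h A)].
suff : <<s @open E >> `<=` G by apply.
apply: smallest_sub => [|U]; last exact: measurable_subgradient_open.
split.
- rewrite /G /= (_ : subgradient_image h set0 = set0) ?measurable0//.
  by apply/seteqP; split => // p [].
- move=> B GB; rewrite /G /= setTD.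
  pose N := subgradient_image h (~` B) `&` subgradient_image h B.
  have -> : subgradient_image h (~` B) =
      (subgradient_image h setT `\` subgradient_image h B) `|` N.
    apply/seteqP; split => p.
      move=> [x Bx px]; have [Bp|Bp] := pselect (subgradient_image h B p).
        by right; split => //; exists x.
      by left; split => //; exists x.
    move=> [[[x _ px] Bp]|[]//]; exists x => // Bx; apply: Bp; by exists x.
  apply: measurableU.
    by apply: measurableD => //; apply: measurable_subgradient_open; exact: openT.
  apply: measurable_null; apply: Vol_null_sub (Vol_multi_subgradient cP P0 vP hl).
  by apply: subgradient_image_disjoint; rewrite setIC setICr.
- by move=> B GB; rewrite /G/= subgradient_image_bigcup; exact: bigcupT_measurable.
Qed.

Definition subgradient_volume (A : set borelE) : \bar R :=
  Vol (subgradient_image h A).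

Lemma subgradient_volume0 : subgradient_volume set0 = 0%E.
Proof.
by rewrite /subgradient_volume (_ : subgradient_image h _ = set0) ?Vol_set0//;
  apply/seteqP; split => // p [].
Qed.

Lemma subgradient_volume_ge0 A : (0 <= subgradient_volume A)%E.
Proof. exact: Vol_ge0. Qed.

Lemma subgradient_volume_sigma_additive : semi_sigma_additive subgradient_volume.
Proof.
move=> A mA tA mUA.
have N0 := Vol_multi_subgradient cP P0 vP hl.
pose B k := subgradient_image h (A k) `\` multi_subgradient h.
have VB (C : set E) : Vol C = Vol (C `\` multi_subgradient h) by rewrite Vol_setD_null.
rewrite /subgradient_volume subgradient_image_bigcup VB.
under eq_fun do under eq_bigr do rewrite VB.
rewrite setDE setI_bigcupl; under eq_bigcupr do rewrite -setDE.
have mB k : lebesgue_measurable (B k).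
  by apply: measurableD; [exact: measurable_subgradient_image|exact: measurable_null].
have tB : trivIset setT B.
  move=> i j _ _ [p [[Ap Np] [Ajp _]]]; apply: tA => //.
  apply: contrapT => /set0P/negP; rewrite negbK => /eqP AA; apply: Np.
  exact: (subgradient_image_disjoint AA (conj Ap Ajp)).
exact: (@caratheodory_measure_sigma_additive _ _ Vol_outer B mB tB
  (bigcupT_measurable _ mB)).
Qed.

HB.instance Definition _ := isMeasure.Build _ _ R subgradient_volume
  subgradient_volume0 subgradient_volume_ge0 subgradient_volume_sigma_additive.

Definition subgradient_measure : {measure set borelE -> \bar R} :=
  subgradient_volume.

End SubgradientMeasure.

(** * The semidiscrete problem *)

Section Semidiscrete.
Context {R : realType} {n : nat}.
Local Notation E := 'rV[R]_n.
Variable P : set E.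
Hypotheses (cP : compact P) (VP0 : (0 < Vol P)%E).
Variables (m : nat) (x : 'I_m -> E) (a : 'I_m -> R).
Hypotheses (xinj : injective x) (a0 : forall i, 0 <= a i).
Hypothesis aV : (\sum_i a i)%:E = Vol P.
Implicit Types (c : 'rV[R]_m) (i j : 'I_m) (p q : E).

Definition power c i p : R := dotv (x i) p - c 0 i.

(** The power diagram of the sites [x i] with weights [c i], cut by [P], and the
    complements in [P] of its open cells. *)
Definition cell c i : set E :=
  [set p | P p /\ forall j, power c j p <= power c i p].

Definition cocell c i : set E :=
  [set p | P p /\ exists2 j, j != i & power c i p <= power c j p].

Definition ties c : set E :=
  [set p | P p /\ exists i j, i != j /\ power c i p = power c j p].

Lemma cvg_power c i p : (fun w : E * 'rV[R]_m => power w.2 i w.1) w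
  @[w --> (p, c)] --> power c i p.
Proof.
have c1 : w.1 @[w --> (p, c)] --> p by exact: cvg_fst.
have c2 : w.2 @[w --> (p, c)] --> c by exact: cvg_snd.
have c3 : dotv (x i) w.1 @[w --> (p, c)] --> dotv (x i) p.
  exact: (@dotv_cvg R n _ _ (fun=> x i) fst (x i) p _ (cvg_cst (x i)) c1).
have c4 : (fun w : E * 'rV[R]_m => w.2 0 i) w @[w --> (p, c)] --> c 0 i.
  exact: (cvg_comp _ (fun c : 'rV[R]_m => c 0 i) c2 (@coord_continuous R 1 m 0 i c)).
exact: (cvgB c3 c4).
Qed.

Lemma near_power_lt c i j p : power c i p < power c j p ->
  \forall q \near p & d \near c, power d i q < power d j q.
Proof.
rewrite -subr_gt0 => pos; have cuv := cvgB (@cvg_power c j p) (@cvg_power c i p).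
have : \forall w \near filter_prod (nbhs p) (nbhs c),
    0 < power w.2 j w.1 - power w.2 i w.1 by have /cuv := lt_nbhsr pos.
by apply: filterS => -[q d] /=; rewrite subr_gt0.
Qed.

Lemma cell_usc c i (r : R) : (Vol (cell c i) < r%:E)%E ->
  \forall d \near c, (Vol (cell d i) < r%:E)%E.
Proof.
move=> Vr; apply: (@Vol_usc R n P cP _ (nbhs c) (fun d => cell d i) _ _ _ _ _ Vr) =>
  [d p []//|p Pp].
move=> /not_andP[//|/existsNP[j]].
move=> /negP; rewrite -ltNge => /near_power_lt.
by apply: filterS => -[q d] /= lt [_ /(_ j)]; rewrite leNgt lt.
Qed.

Lemma cocell_usc c i (r : R) : (Vol (cocell c i) < r%:E)%E ->
  \forall d \near c, (Vol (cocell d i) < r%:E)%E.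
Proof.
move=> Vr; apply: (@Vol_usc R n P cP _ (nbhs c) (fun d => cocell d i) _ _ _ _ _ Vr) =>
  [d p []//|p Pp].
move=> /not_andP[//|/forall2NP cp].
have : \forall qd \near filter_prod (nbhs p) (nbhs c), forall j, j != i ->
    power qd.2 j qd.1 < power qd.2 i qd.1.
  apply: (@filter_forall _ _ (fun j (qd : E * 'rV[R]_m) => j != i ->
    power qd.2 j qd.1 < power qd.2 i qd.1) (filter_prod (nbhs p) (nbhs c))) => j.
  have [->|ji] := eqVneq j i; first by apply: nearW => qd /eqP.
  have [] := cp j => // /negP; rewrite -ltNge => /near_power_lt.
  by apply: filterS => -[q d].
by apply: filterS => -[q d] /= lt [_ [j ji]]; rewrite leNgt lt.
Qed.

Lemma power_diff_continuous c i j :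
  continuous (fun p => power c i p - power c j p).
Proof.
have cont k : continuous (fun p => power c k p).
  move=> p; apply: (@cvgB R R E (nbhs p) _ (fun p => dotv (x k) p) (fun=> c 0 k)).
    exact: (@dotv_cvg R n E (nbhs p) (fun=> x k) id (x k) p _ (cvg_cst _) cvg_id).
  exact: cvg_cst.
by move=> p; exact: (cvgB (cont i p) (cont j p)).
Qed.

Lemma cell_compact c i : compact (cell c i).
Proof.
have -> : cell c i = P `&` \bigcap_(j in setT)
    [set p | power c i p - power c j p >= 0].
  apply/seteqP; split => p [Pp cp]; split => // j; first by move=> _ /=; rewrite subr_ge0.
  by have := cp j Logic.I; rewrite /= subr_ge0.
apply: compact_closedI => //; apply: closed_bigI => j _.
exact: (@preimage_closed E R _ [set t | 0 <= t]
  (fun p _ => @power_diff_continuous c i j p) (@closed_ge R 0)).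
Qed.

(** Ties between two different sites lie on a hyperplane. *)
Lemma Vol_ties c : Vol (ties c) = 0%E.
Proof.
pose T (ij : 'I_m * 'I_m) : set E := [set p | P p /\
  power c ij.1 p = power c ij.2 p].
apply: (@Vol_null_sub _ _ _ (\bigcup_(ij in [set ij | ij.1 != ij.2]) T ij)).
  by move=> p [Pp [i [j [ij pij]]]]; exists (i, j).
apply: Vol_null_bigcup => -[i j] /= ij.
have cT : compact (T (i, j)).
  have -> : T (i, j) = P `&`
      [set p | power c i p - power c j p = 0].
    apply/seteqP; split => p [Pp /= pij]; split => //=; first by rewrite pij subrr.
    by apply/eqP; rewrite -subr_eq0 pij.
  apply: compact_closedI => //.
  exact: (@preimage_closed E R _ [set t | t = 0]
    (fun p _ => @power_diff_continuous c i j p) (@closed_eq R 0)).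
apply: (Vol0_of_transverse (v := x i - x j) cT) => p t t0 [_ /= p1] [_ /= p2].
have : t * dotv (x i - x j) (x i - x j) = 0.
  by rewrite -dotvZr dotvBl; move: p1 p2; rewrite /power !dotvDr; lra.
move/eqP; rewrite mulf_eq0 gt_eqF//= dotv_eq0 subr_eq0 => /eqP/xinj/eqP.
by rewrite (negbTE ij).
Qed.


Let V : R := \sum_i a i.

Lemma cell_cover c (i0 : 'I_m) : P `<=` \bigcup_i cell c i.
Proof.
move=> p Pp; have [i _ imax] := @arg_maxP _ R _ i0 xpredT (fun i => power c i p) isT.
by exists i => //; split => // j; exact: imax.
Qed.

(** Up to ties, a cell and the corresponding cocell partition [P]. *)
Lemma Vol_cell_le c i : ((V - a i)%:E <= Vol (cocell c i))%E ->
  (Vol (cell c i) <= (a i)%:E)%E.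
Proof.
move=> Vi; have cPi : P `&` cell c i = cell c i by apply/setIidr => p [].
have := @Vol_split R n (cell c i) P (measurable_compact (@cell_compact c i)).
rewrite cPi -aV => split.
have : (Vol (cocell c i) <= Vol (P `\` cell c i))%E.
  rewrite -(Vol_setD_null _ (Vol_ties c)); apply: Vol_le => p [[Pp [j ji pj]] tp].
  split => // -[_ pi]; apply: tp; split => //; exists i, j; split.
    by rewrite eq_sym.
  by apply/eqP; rewrite eq_le pj pi.
move=> /(le_trans Vi) Vi'.
have [vP vC] : Vol (P `\` cell c i) \is a fin_num /\ Vol (cell c i) \is a fin_num.
  by split; rewrite ge0_fin_numE ?Vol_ge0// (@le_lt_trans _ _ (Vol P)) ?Vol_compact//
    Vol_le// => p [].
move: split Vi'; rewrite -(fineK vP) -(fineK vC) -EFinD !lee_fin => -[]; rewrite -/V; lra.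
Qed.

Lemma cocell_setD_cell c i : P `\` cell c i `<=` cocell c i.
Proof.
move=> p [Pp]; move=> /not_andP[//|/existsNP[j /negP]]; rewrite -ltNge => ij.
split => //; exists j; last exact: ltW.
by apply: contraTneq ij => ->; rewrite ltxx.
Qed.

Lemma Vol_cocell_ge c i : (Vol (cell c i) <= (a i)%:E)%E ->
  ((V - a i)%:E <= Vol (cocell c i))%E.
Proof.
move=> Vi; rewrite EFinB leeBlDr// aV.
apply: (@le_trans _ _ (Vol (cocell c i `|` cell c i))).
  apply: Vol_le => p Pp; have [pi|pi] := pselect (cell c i p); first by right.
  by left; apply: cocell_setD_cell.
by rewrite (le_trans (Vol_setU _ _))// leeD2l.
Qed.

Lemma Vol_bigcup_le (I : finType) (J : {pred I}) (F : I -> set E) :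
  (Vol (\bigcup_(i in [set` J]) F i) <= \sum_(i in J) Vol (F i))%E.
Proof.
rewrite bigcup_pred; elim/big_rec2 : _ => [|i v A _ IH]; first by rewrite Vol_set0.
by apply: le_trans (Vol_setU _ _) _; rewrite leeD2l.
Qed.

(** A Perron argument. Lowering one weight enlarges its cell and shrinks the
    others; the weights [c] with [c i0 = 0] whose cells outside [i0] are not too
    large form a compact set, at a point of which with least sum of weights no
    cell can be too small. *)
Lemma semidiscrete_weights : exists c, forall i, ((a i)%:E <= Vol (cell c i))%E.
Proof.
have [i0 ai0] : exists i0, 0 < a i0.
  apply: contrapT => /forallNP aN; move: VP0; rewrite -aV big1 ?ltxx// => i _.
  by apply/eqP; rewrite eq_le a0 andbT leNgt; apply/negP/aN.
have [D D0 xD] : exists2 D, 0 <= D & forall i p, P p -> `|dotv (x i) p| <= D.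
  have /ex_strict_bound_gt0[M M0 PM] := compact_bounded cP.
  exists (n%:R * (\sum_i `|x i|) * M).
    by rewrite !mulr_ge0 ?(ltW M0)//; apply: sumr_ge0.
  move=> i p /PM pM; apply: le_trans (dotv_le_norm _ _) _; rewrite -mulrA.
  rewrite ler_wpM2l// ler_pM ?(ltW pM)//.
  by rewrite (bigD1 i)//= lerDl sumr_ge0.
(* If [c i0 = 0], site [i] loses to [i0] everywhere on [P] when its weight is [B]
   and wins everywhere when its weight is at most [- B]. *)
pose B := 2 * D + 1.
pose S := [set c : 'rV[R]_m | c 0 i0 = 0 /\ forall i, i != i0 ->
  - B <= c 0 i <= B /\ ((V - a i)%:E <= Vol (cocell c i))%E].
have cS : compact S.
  apply: bounded_closed_compact.
    exists B; split; first exact: num_real.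
    move=> N /ltW BN c [c0 cS] /=; apply: le_trans BN; apply: norm_le_coord.
      by rewrite /B; lra.
    move=> i; have [->|/cS[cB _]] := eqVneq i i0; last by rewrite ler_norml.
    by rewrite c0 normr0 /B; lra.
  have -> : S = [set c : 'rV[R]_m | c 0 i0 = 0] `&` \bigcap_(i in [set i | i != i0])
      ([set c : 'rV[R]_m | - B <= c 0 i] `&` [set c : 'rV[R]_m | c 0 i <= B] `&`
       [set c : 'rV[R]_m | ((V - a i)%:E <= Vol (cocell c i))%E]).
    apply/seteqP; split => c [c0 cS]; split => // i /cS/=.
      by move=> [/andP[? ?] ?]; split.
    by move=> [[/= -> ->] ?]; split.
  apply: closedI.
    exact: (@preimage_closed _ R (fun c : 'rV[R]_m => c 0 i0) [set t | t = 0]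
      (fun c _ => @coord_continuous R 1 m 0 i0 c) (@closed_eq R 0)).
  apply: closed_bigI => i _; apply: closedI.
    by apply: closedI; [exact: closed_coord_ge|exact: closed_coord_le].
  rewrite -[X in closed X]setCK; apply: open_closedC; rewrite openE => c /= /negP.
  rewrite -ltNge => /cocell_usc; apply: filterS => d.
  by rewrite ltNge => /negP.
have S0 : S !=set0.
  exists (\row_i if i == i0 then 0 else B); split; first by rewrite mxE eqxx.
  move=> i ii0; rewrite mxE (negbTE ii0) lexx andbT; split; first by rewrite /B; lra.
  apply: (@le_trans _ _ (Vol P)); first by rewrite -aV lee_fin -/V; have := a0 i; lra.
  apply: Vol_le => p Pp; split => //; exists i0; first by rewrite eq_sym.
  rewrite /power !mxE eqxx (negbTE ii0).
  have := xD i _ Pp; have := xD i0 _ Pp; rewrite !ler_norml /B; lra.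
have csum : {within S, continuous (fun c : 'rV[R]_m => \sum_i c 0 i)}.
  apply: continuous_subspaceT.
  apply: (@continuous_big R 'I_m +%R 0 xpredT _ 'rV[R]_m _ (fun i c => c 0 i)).
    exact: add_continuous.
  by move=> i _; exact: coord_continuous.
have [c /set_mem[c0 cP'] cmin] := EVT_min_rV S0 cS csum.
have cell_le i : i != i0 -> (Vol (cell c i) <= (a i)%:E)%E.
  by move=> /cP'[_]; exact: Vol_cell_le.
have cover_le : ((V - a i0)%:E >= \sum_(i in predC1 i0) Vol (cell c i))%E.
  have -> : V - a i0 = \sum_(i | i != i0) a i.
    by rewrite /V (bigD1 i0)//= addrAC subrr add0r.
  by rewrite -sumEFin; apply: lee_sum => i; exact: cell_le.
(* Otherwise the cell of [i0] is empty, and the other ones are too small to cover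
   [P]. *)
have c_gt i : i != i0 -> - B < c 0 i.
  move=> ii0; rewrite ltNge; apply/negP => ciB.
  suff : (Vol P <= (V - a i0)%:E)%E by rewrite -aV lee_fin -/V; lra.
  apply: le_trans cover_le; apply: le_trans (Vol_bigcup_le _ _); apply: Vol_le => p Pp.
  have [j _ pj] := cell_cover c i0 Pp; exists j => //; rewrite /= inE.
  apply/eqP => ji0; have := pj.2 i; rewrite ji0 leNgt => /negP; apply.
  rewrite /power c0; have := xD i _ Pp; have := xD i0 _ Pp.
  rewrite !ler_norml; move: ciB; rewrite /B; lra.
have cell_ge i : i != i0 -> ((a i)%:E <= Vol (cell c i))%E.
  move=> ii0; rewrite leNgt; apply/negP => /cell_usc/nbhs_ballP[e /= e0 ce].
  (* Lowering [c i] by [t] stays in [S] and decreases the sum of the weights. *)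
  pose t := Num.min (e / 2) (c 0 i + B).
  have t0 : 0 < t by rewrite lt_min divr_gt0//=; have := c_gt _ ii0; lra.
  have te : t < e by rewrite (@le_lt_trans _ _ (e / 2)) ?ge_min ?lexx//; lra.
  have tB : t <= c 0 i + B by rewrite ge_min lexx orbT.
  pose d := c - t *: delta_mx 0 i.
  have dE j : d 0 j = if j == i then c 0 j - t else c 0 j.
    rewrite !mxE eqxx /=; case: eqVneq => _; first by rewrite mulr1.
    by rewrite mulr0 subr0.
  have Vd : (Vol (cell d i) < (a i)%:E)%E.
    apply: ce; rewrite -ball_normE /= /d opprB addrC subrK.
    apply: le_lt_trans te; apply: norm_le_coord => [|j]; first exact: ltW.
    rewrite !mxE eqxx /=; case: eqVneq => _; last by rewrite mulr0 normr0 ltW.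
    by rewrite mulr1 ger0_norm// ltW.
  have Sd : S d.
    split; first by rewrite dE eq_sym (negbTE ii0).
    move=> j ji0; have [/andP[cj1 cj2] Vj] := cP' j ji0; rewrite dE.
    have [->{j ji0 cj1 cj2 Vj}|ji] := eqVneq j i.
      have [/andP[ci1 ci2] _] := cP' i ii0.
      split; first by apply/andP; split; lra.
      by apply: Vol_cocell_ge; exact: ltW.
    split; first by rewrite cj1 cj2.
    apply: le_trans Vj _; apply: Vol_le => p [Pp [k kj pk]].
    split => //; exists k => //.
    have dj : power d j p = power c j p by rewrite /power dE (negbTE ji).
    have dk : power c k p <= power d k p.
      by rewrite /power dE lerD2l lerN2; case: ifP => // _; lra.
    by rewrite dj (le_trans pk).
  have := cmin d (mem_set Sd); rewrite (bigD1 i)//= [in leRHS](bigD1 i)//= dE eqxx.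
  rewrite [X in _ <= _ + X](eq_bigr (fun j => c 0 j)) => [|j /negbTE ji].
    by rewrite lerD2r; lra.
  by rewrite dE ji.
exists c => i; have [->|] := eqVneq i i0; last exact: cell_ge.
have : (Vol P <= Vol (cell c i0) + (V - a i0)%:E)%E.
  apply: (@le_trans _ _ (\sum_(i in predT) Vol (cell c i))%E).
    apply: le_trans (Vol_bigcup_le _ _); apply: Vol_le => p Pp.
    by have [j _ pj] := cell_cover c i0 Pp; exists j.
  by rewrite (bigD1 i0)//= leeD2l.
have vC : Vol (cell c i0) \is a fin_num.
  by rewrite ge0_fin_numE ?Vol_ge0// Vol_compact//; exact: cell_compact.
by rewrite -aV -(fineK vC) -EFinD !lee_fin -/V; lra.
Qed.

(** Up to ties the cells are disjoint, so their volumes add up. *)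
Lemma semidiscrete : exists c, forall J : {pred 'I_m},
  ((\sum_(i in J) a i)%:E <= Vol (\bigcup_(i in [set` J]) cell c i))%E.
Proof.
have [c cV] := semidiscrete_weights; exists c => J.
pose F i := cell c i `\` ties c.
have mF i : lebesgue_measurable (F i).
  apply: measurableD; first exact: measurable_compact (@cell_compact c i).
  by apply: measurable_null; exact: Vol_ties.
apply: (@le_trans _ _ (Vol (\big[setU/set0]_(i in J) F i))); last first.
  apply: Vol_le; rewrite -bigcup_pred => p [i Ji [pi _]]; by exists i.
have tF : trivIset [set` J] F.
  move=> i j _ _ [p [[pi tp] [pj _]]]; apply/eqP; apply: contrapT => /negP ij.
  apply: tp; split; first by case: pi.
  by exists i, j; split => //; apply/eqP; rewrite eq_le pi.2 pj.2.
have -> : Vol (\big[setU/set0]_(i in J) F i) = (\sum_(i in J) Vol (F i))%E.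
  exact: (@measure_bigsetU_ord_cond _ _ _
    (Vol_outer : set (caratheodory_type Vol_outer) -> \bar R) m J F).
rewrite -sumEFin; apply: lee_sum => i _; apply: le_trans (cV i) _.
by rewrite -(Vol_setD_null _ (Vol_ties c)).
Qed.

End Semidiscrete.

(** * Existence *)

Section Existence.
Context {R : realType} {n : nat}.
Local Notation E := 'rV[R]_n.
Local Notation borelE := (borel_rV R n).
Variable P : set E.
Hypotheses (cP : compact P) (P0 : P !=set0).
Hypothesis vP : convex_set (P : set (convex_lmodType E)).

(** The Legendre transform on [P] of the maximum of the affine functions
    [power x c i]: its subgradients at [x i] contain the [i]-th cell. *)
Lemma exists_function_of_weights (m : nat) (x : 'I_m -> E) (c : 'rV[R]_m) :
  (0 < m)%N -> exists h : E -> R, [/\ convex_on_rV h, support_lipschitz P h,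
    h 0 = 0 & forall i, cell P x c i `<=` subgradient h (x i)].
Proof.
case: m x c => // m x c _.
pose k p := [arg max_(i > ord0) power x c i p]%O.
pose phi p := power x c (k p) p.
have phi_ge p i : power x c i p <= phi p.
  by rewrite /phi /k; case: arg_maxP => // j _; exact.
pose h y := sup [set dotv p y - phi p | p in P].
have hub y : has_ubound [set dotv p y - phi p | p in P].
  exists (support_function P (y - x ord0) + c 0 ord0) => _ [p Pp <-].
  have := dotv_le_support cP (y - x ord0) Pp; have := phi_ge p ord0.
  rewrite /power dotvBr (dotvC p (x _)); lra.
have h_ge y p : P p -> dotv p y - phi p <= h y.
  by move=> Pp; apply: ub_le_sup => //; exists p.
have h_le y r : (forall p, P p -> dotv p y - phi p <= r) -> h y <= r.
  move=> pr; apply: ge_sup; first exact: image_nonempty.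
  by move=> _ [p Pp <-]; exact: pr.
exists (fun y => h y - h 0); split.
- apply/convex_on_rVP => t y z /andP[t0 t1].
  rewrite -subr_ge0; have : h (t *: y + (1 - t) *: z) <= t * h y + (1 - t) * h z.
    apply: h_le => p Pp; rewrite dotvDr !dotvZr.
    by have := h_ge y _ Pp; have := h_ge z _ Pp; nra.
  lra.
- move=> y z; rewrite opprB addrA subrK lerBlDr; apply: h_le => p Pp.
  have := dotv_le_support cP (z - y) Pp; have := h_ge y _ Pp.
  rewrite dotvBr; lra.
- by rewrite subrr.
- move=> i p [Pp pi] y.
  have phiE : phi p = power x c i p by apply/eqP; rewrite eq_le phi_ge pi.
  have hx : h (x i) <= c 0 i.
    apply: h_le => q Pq; have := phi_ge q i; rewrite /power dotvC; lra.
  have := h_ge y _ Pp; rewrite phiE /power dotvBr (dotvC (x i)); lra.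
Qed.

Local Notation T := (prod_topology (fun _ : E => R)).

Definition normalized_class : set T :=
  [set h : T | [/\ convex_on_rV h, support_lipschitz P h & h 0 = 0]].

Lemma eval_continuous (x : E) : continuous (fun h : T => h x).
Proof. exact: proj_continuous. Qed.

(** The values at [x] are confined to a compact interval and the defining conditions
    are closed, so that Tychonoff's theorem applies. *)
Lemma normalized_class_compact : compact normalized_class.
Proof.
pose A (x : E) : set R := `[- support_function P (- x), support_function P x]%classic.
have cA : compact [set h : T | forall x, A x (h x)].
  by apply: (@tychonoff E (fun=> R) A) => x; exact: segment_compact.
apply: (subclosed_compact _ cA); last first.
  move=> h [_ hl h0] x; rewrite /A /= in_itv /=.
  have := hl 0 x; have := hl x 0; rewrite h0 !subr0 !sub0r => *; apply/andP; split; lra.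
have -> : normalized_class =
    (\bigcap_(s in [set s : R * (E * E) | 0 <= s.1 <= 1])
      [set h : T | 0 <= s.1 * h s.2.1 + (1 - s.1) * h s.2.2
         - h (s.1 *: s.2.1 + (1 - s.1) *: s.2.2)]) `&`
    (\bigcap_(s in [set: E * E])
      [set h : T | h s.2 - h s.1 <= support_function P (s.2 - s.1)]) `&`
    [set h : T | h 0 = 0].
  apply/seteqP; split => h.
    move=> [/convex_on_rVP hc hl h0]; split => //; split => [[t [y z]] /= t01|[y z] _].
      by rewrite subr_ge0; exact: hc.
    exact: hl.
  move=> [[hc hl] h0]; split => //; last by move=> y z; exact: (hl (y, z)).
  apply/convex_on_rVP => t y z t01; rewrite -subr_ge0.
  exact: (hc (t, (y, z))).
have ev (x : E) (h : T) : (fun h : T => h x) g @[g --> h] --> h x.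
  exact: eval_continuous.
apply: closedI; first apply: closedI; first apply: closed_bigI => -[t [y z]] _ /=.
- apply: (@preimage_closed T R _ [set r | 0 <= r] _ (@closed_ge R 0)) => h _.
  exact: (cvgB (cvgD (cvgM (cvg_cst t) (ev y h)) (cvgM (cvg_cst _) (ev z h))) (ev _ h)).
- apply: closed_bigI => -[y z] _ /=.
  apply: (@preimage_closed T R _ [set r | r <= support_function P (z - y)] _ (@closed_le R _)) => h _.
  exact: (cvgB (ev z h) (ev y h)).
- by apply: (@preimage_closed T R _ [set r | r = 0] _ (@closed_eq R 0)) => h _; exact: ev.
Qed.

(** Upper semicontinuity along the neighbourhood filter of [h]. *)
Lemma closure_subgradient_volume (K : set E) (r : R) (h : T) : compact K ->
  normalized_class h ->
  closure [set g : T | normalized_class g /\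
    (r%:E <= Vol (subgradient_image g K))%E] h ->
  (r%:E <= Vol (subgradient_image h K))%E.
Proof.
move=> cK [_ hl _] clh; rewrite leNgt; apply/negP => hr.
(* Functions outside the class are replaced by [h], so that semicontinuity can be
   applied to a family of functions of the class. *)
pose G (g : T) : T := if pselect (support_lipschitz P g) then g else h.
have Gl g : support_lipschitz P (G g) by rewrite /G; case: pselect.
have Gh x : G g x @[g --> h] --> h x.
  move=> A nA; have Ahx : A (h x) := nbhs_singleton nA.
  have nAh : \forall g \near (h : T), A (g x) := @eval_continuous x h A nA.
  apply: (@filterS T (nbhs h) (nbhs_filter h) _ _ _ nAh) => g /= Agx.
  by rewrite /G; case: pselect.
have /clh[g [[[_ gl _] rg] gr]] :=
  subgradient_image_usc cP P0 vP (nbhs_filter h) Gl Gh cK hr.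
move: gr; rewrite /= /G; case: pselect => //= _.
by rewrite ltNge rg.
Qed.


Variable mu : {measure set borelE -> \bar R}.
Hypotheses (muP : mu setT = Vol P) (VP0 : (0 < Vol P)%E).

Lemma mu_fin (A : set borelE) : measurable A -> mu A \is a fin_num.
Proof.
move=> mA; rewrite ge0_fin_numE//; apply: (@le_lt_trans _ _ (mu setT)).
  by apply: le_measure => //; exact: mem_set.
by rewrite muP Vol_compact.
Qed.

(** The atoms of the Boolean algebra generated by the [K i] are concentrated on
    one point each, which turns the problem into a semidiscrete one. *)
Lemma exists_dominating_fin (I : finType) (K : I -> set borelE) :
  (forall i, measurable (K i)) -> exists h, normalized_class h /\
    forall i, (mu (K i) <= Vol (subgradient_image h (K i)))%E.
Proof.
move=> mK; pose sig (x : E) := [ffun i => `[< K i x >]] : {ffun I -> bool}.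
pose J := [pred s | `[< exists x, sig x = s >]].
have Jsig x : sig x \in J by rewrite inE; apply/asboolP; exists x.
pose A (k : 'I_#|J|) : set borelE := [set x | sig x = enum_val k].
have mA k : measurable (A k).
  have -> : A k = \bigcap_(i in [set: I]) (if enum_val k i then K i else ~` K i).
    apply/seteqP; split => [x /= <- i _|x Ax].
      by rewrite ffunE; case: asboolP.
    apply/ffunP => i; rewrite ffunE; have := Ax i Logic.I.
    by case: ifP => _ Kx; [exact/asboolP|apply/asboolPn].
  apply: fin_bigcap_measurable => // i _; case: ifP => _ //.
  exact: measurableC.
have tA : trivIset setT A.
  move=> k l _ _ [x [/= xk xl]]; apply: enum_val_inj.
  by rewrite -xk -xl.
have AK (Q : {pred 'I_#|J|}) : mu (\bigcup_(k in [set` Q]) A k) =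
    (\sum_(k in Q) mu (A k))%E.
  rewrite bigcup_pred; apply: measure_bigsetU_ord_cond => //.
  exact: sub_trivIset tA.
pose k0 x : 'I_#|J| := enum_rank_in (Jsig 0) (sig x).
have k0P x : enum_val (k0 x) = sig x by rewrite enum_rankK_in.
have xex (k : 'I_#|J|) : exists x, sig x = enum_val k.
  by have := enum_valP k; rewrite inE => /asboolP.
have [x xP] := choice xex.
pose a k := fine (mu (A k)).
have aE k : (a k)%:E = mu (A k) by rewrite fineK// mu_fin.
have xinj : injective x.
  by move=> k l xkl; apply: enum_val_inj; rewrite -!xP xkl.
have a0 k : 0 <= a k by rewrite fine_ge0.
have aV : (\sum_k a k)%:E = Vol P.
  rewrite -sumEFin; under eq_bigr do rewrite aE.
  have := AK predT => /esym; rewrite (eq_bigl predT)// => ->; rewrite -muP.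
  by congr (mu _); apply/seteqP; split => // y _; exists (k0 y).
have [c cV] := semidiscrete cP VP0 xinj a0 aV.
have m0 : (0 < #|J|)%N by apply/card_gt0P; exists (sig 0).
have [h [hc hl h0 hcell]] := exists_function_of_weights x c m0.
exists h; split => // i.
pose Q : {pred 'I_#|J|} := fun k => enum_val k i.
have KQ : K i = \bigcup_(k in [set` Q]) A k.
  apply/seteqP; split => [y Ky|y [k /= Qk sy]].
    exists (k0 y); last by rewrite /A /= k0P.
    by rewrite /= /in_mem /= /Q k0P ffunE; exact/asboolP.
  by move: Qk; rewrite /in_mem /= /Q -sy ffunE => /asboolP.
rewrite {1}KQ AK; under eq_bigr do rewrite -aE.
rewrite sumEFin; apply: le_trans (cV Q) _; apply: Vol_le => p [k Qk pk].
exists (x k); last exact: hcell.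
by rewrite KQ; exists k => //; exact: xP.
Qed.

(** The sets of normalized functions that dominate [mu] on one compact set are closed
    in a compact space and have the finite intersection property. *)
Lemma exists_dominating : exists h, normalized_class h /\
  forall K : set borelE, compact (K : set E) ->
    (mu K <= Vol (subgradient_image h K))%E.
Proof.
pose T := prod_topology (fun _ : E => R).
pose F (K : set E) : set T := [set g : T | normalized_class g /\
  ((fine (mu K))%:E <= Vol (subgradient_image g K))%E].
have mK (K : set E) : compact K -> measurable (K : set borelE).
  by move=> /compact_closed_rV/borel_closed.
have finF : finI [set K : set E | compact K] F.
  move=> D Dcompact.
  have mD (K : D) : measurable (val K : set borelE).
    by apply: mK; exact: set_mem (Dcompact _ (valP K)).
  have [h [hn hK]] := exists_dominating_fin mD.
  exists h => K KD; split => //.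
  have cK : compact K by exact: set_mem (Dcompact _ KD).
  by rewrite fineK ?mu_fin//; [exact: (hK [` KD]%fset)|exact: mK].
have FK K : compact K ->
    filter_from (finI_from [set K : set E | compact K] F) id (F K).
  by move=> cK; exists (F K) => //; exact: finI_from1.
have [|h [hn hF]] := normalized_class_compact (finI_filter finF).
  by exists (F set0) => [|g []//]; apply: finI_from1; exact: compact0.
exists h; split => // K cK; rewrite -(fineK (mu_fin (mK _ cK))).
apply: closure_subgradient_volume => //.
by move=> B nB; exact: hF (FK _ cK) nB.
Qed.

(** A finite measure that dominates another one of the same mass on compact sets,
    hence on open and on closed sets, is equal to it. *)
Lemma exists_solution : exists h : E -> R, [/\ convex_on_rV h,
  support_lipschitz P h & forall A : set borelE, measurable A ->
    Vol (subgradient_image h A) = mu A].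
Proof.
have [h [[hc hl _] hK]] := exists_dominating; exists h; split => // A mA.
pose nu : {measure set borelE -> \bar R} := subgradient_measure cP P0 vP hl.
have nuE B : nu B = Vol (subgradient_image h B) by [].
have nu_fin (B : set borelE) : nu B \is a fin_num.
  rewrite ge0_fin_numE// nuE (@le_lt_trans _ _ (Vol P)) ?Vol_compact//.
  by apply: Vol_le; exact: subgradient_image_sub.
have dom (K : nat -> set E) : (forall k, compact (K k)) -> nondecreasing_seq K ->
    (mu (\bigcup_k K k : set borelE) <= nu (\bigcup_k K k : set borelE))%E.
  move=> cK ndK; have mK k : measurable (K k : set borelE).
    by apply: borel_closed; exact: compact_closed_rV.
  have mUK : measurable (\bigcup_k K k : set borelE) by exact: bigcupT_measurable.
  have cvgK := nondecreasing_cvg_mu mK mUK ndK.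
  rewrite -(cvg_lim _ (cvgK R mu))//; apply: lime_le; first by apply/cvg_ex; eexists; exact: cvgK.
  apply: nearW => k; apply: le_trans (hK _ (cK k)) _; apply: Vol_le.
  by apply: subgradient_image_subset => x Kx; exists k.
have total : (nu setT <= mu setT)%E.
  by rewrite muP nuE; apply: Vol_le; exact: subgradient_image_sub.
have nuU (U : set E) : open U -> nu (U : set borelE) = mu U.
  move=> oU.
  have [K [cK ndK UK]] := open_compact_bigcup oU.
  have [L [cL ndL UL]] := closed_compact_bigcup (open_closedC oU).
  have le1 : (mu (U : set borelE) <= nu (U : set borelE))%E by rewrite UK; exact: dom.
  have le2 : (mu (~` U : set borelE) <= nu (~` U : set borelE))%E by rewrite UL; exact: dom.
  have mU := borel_open oU; have mUC : measurable (~` U : set borelE) := measurableC mU.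
  have split (m : {measure set borelE -> \bar R}) : m setT = (m U + m (~` U))%E.
    by rewrite -(measureU m mU mUC) ?setICr ?setUCr.
  move: total le1 le2; rewrite !split.
  rewrite -(fineK (nu_fin U)) -(fineK (nu_fin (~` U))) -(fineK (mu_fin mU)).
  rewrite -(fineK (mu_fin mUC)) -!EFinD !lee_fin => *; congr EFin; lra.
apply: (@measure_unique _ R borelE (@open E) (fun=> setT) erefl _ _ _ nu mu) => //.
- exact: openI.
- by move=> _; exact: openT.
- by apply/seteqP; split => // x _; exists 0%N.
- by move=> _; rewrite -ge0_fin_numE.
Qed.



End Existence.

(** * Uniqueness *)

Section Uniqueness.
Context {R : realType} {n : nat}.
Local Notation E := 'rV[R]_n.
Local Notation borelE := (borel_rV R n).
Variable P : set E.
Hypotheses (cP : compact P) (P0 : P !=set0).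
Hypothesis vP : convex_set (P : set (convex_lmodType E)).
Implicit Types (x y z p q : E) (h g : E -> R).

(** The minimum [y] of [h + k/2 |. - x|^2] has the subgradient [k (x - y)]. *)
Lemma subgradient_dense h x (e : R) : convex_on_rV h -> support_lipschitz P h ->
  0 < e -> exists y p, `|y - x| < e /\ subgradient h y p.
Proof.
move=> /convex_on_rVP hc hl e0; have [M M0 hM] := support_lipschitz_norm cP P0.
pose k := 2 * M + 2 * M / e + 1.
have ke0 : 0 < 2 * M / e by rewrite !(mulr_gt0, invr_gt0).
have k0 : 0 < k by rewrite /k; lra.
pose f y := h y + k / 2 * dotv (y - x) (y - x).
have f_ge y : h x - M * `|y - x| + k / 2 * `|y - x| ^+ 2 <= f y.
  apply: lerD.
    by have := hM h hl x y; rewrite ler_norml => /andP[]; lra.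
  by rewrite ler_wpM2l ?norm_sqr_le_dotv// divr_ge0// ltW.
have fx : f x = h x by rewrite /f subrr dotv0l mulr0 addr0.
pose K := [set y : E | `|y| <= `|x| + 1 /\ setT y].
have cK : compact K by exact: compact_ballI closedT.
have Kx : K x by split => //; rewrite lerDl.
have cf : {within K, continuous f}.
  apply: continuous_subspaceT => y.
  have cy : z - x @[z --> y] --> y - x by apply: (cvgB cvg_id (cvg_cst x)).
  have cd : dotv (z - x) (z - x) @[z --> y] --> dotv (y - x) (y - x).
    exact: (@dotv_cvg R n E (nbhs y) (fun z => z - x) (fun z => z - x) _ _ _ cy cy).
  have ch : h z @[z --> y] --> h y by exact: (support_lipschitz_continuous cP P0 hl).
  have cm : k / 2 * dotv (z - x) (z - x) @[z --> y] --> k / 2 * dotv (y - x) (y - x).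
    exact: (cvgM (cvg_cst (k / 2)) cd).
  exact: (cvgD ch cm).
have [y /set_mem[Ky _] ymin'] := EVT_min_rV (ex_intro _ x Kx) cK cf.
have ymin z : f y <= f z.
  have [zK|Kz] := leP `|z| (`|x| + 1); first by apply: ymin'; apply/mem_set; split.
  apply: le_trans (ymin' x (mem_set Kx)) _; rewrite fx; apply: le_trans (f_ge z).
  have z1 : 1 <= `|z - x|.
    by have := ler_distD 0 z x; have := lerB_dist z x; rewrite /=; lra.
  have kM : M <= k / 2 by rewrite /k; lra.
  move: (`|z - x|) (k / 2) z1 kM => d c d1 cM.
  have a1 : 0 <= d * (c - M) by apply: mulr_ge0; lra.
  have a2 : 0 <= c * d * (d - 1) by apply: mulr_ge0; [apply: mulr_ge0|]; lra.
  nra.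
exists y, (k *: (x - y)); split.
  have := f_ge y; have := ymin x; rewrite fx => fy1 /le_trans/(_ fy1).
  have [->//|d0] := eqVneq `|y - x| 0.
  have d1 : 0 < `|y - x| by rewrite lt_neqAle eq_sym d0 normr_ge0.
  move: (`|y - x|) d1 => d d1 fd.
  have : k * d <= 2 * M by nra.
  rewrite /k => kd; rewrite ltNge; apply/negP => ed.
  have : 2 * M / e * d >= 2 * M by rewrite mulrAC ler_pdivlMr// ler_wpM2l// mulr_ge0// ltW.
  nra.
move=> z; rewrite dotvZl.
have xy : x - y = - (y - x) by rewrite opprB.
have lin t : 0 < t <= 1 -> 0 <= (h z - h y) + k * dotv (y - x) (z - y) +
    t * (k / 2 * dotv (z - y) (z - y)).
  move=> /andP[t0 t1]; have := ymin (t *: z + (1 - t) *: y).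
  have -> : f (t *: z + (1 - t) *: y) = h (t *: z + (1 - t) *: y) + k / 2 *
      (t ^+ 2 * dotv (z - y) (z - y) + t * dotv (z - y) (y - x) *+ 2
       + dotv (y - x) (y - x)).
    congr (_ + _ * _).
    have -> : t *: z + (1 - t) *: y - x = t *: (z - y) - (x - y).
      by rewrite scalerBr scalerBl scale1r opprB addrA addrAC -!addrA; congr (_ + _); rewrite addrCA.
    rewrite dotv_subZ_sqr xy dotvNr dotvNl dotvNr opprK; ring.
  have := hc t z y; rewrite (ltW t0) t1 => /(_ isT); rewrite /f (dotvC (z - y) (y - x)).
  move: (h (_ + _)) (dotv (z - y) _) (dotv (y - x) (z - y)) (dotv (y - x) (y - x)) => H A B C.
  move=> H1 H2; rewrite -(pmulr_rge0 _ t0); lra.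
rewrite xy dotvNl mulrN.
have C0 : 0 <= k / 2 * dotv (z - y) (z - y).
  by rewrite mulr_ge0 ?dotv_ge0// divr_ge0// ltW.
move: (k / 2 * dotv (z - y) (z - y)) (k * dotv (y - x) (z - y)) C0 lin => C B C0 lin.
rewrite leNgt; apply/negP => neg.
pose t := Num.min 1 ((h y - B - h z) / (2 * (C + 1))).
have t0 : 0 < t by rewrite lt_min ltr01 divr_gt0//; lra.
have t1 : t <= 1 by rewrite ge_min lexx.
have tC : t * (2 * (C + 1)) <= h y - B - h z.
  by rewrite -ler_pdivlMr ?ge_min ?lexx ?orbT//; lra.
have := lin t; rewrite t0 t1 => /(_ isT); nra.
Qed.


(** Limit of the subgradients at points close to [x]: all of them lie in the compact
    set [P]. *)
Lemma subgradient_exists h x : convex_on_rV h -> support_lipschitz P h ->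
  exists p, subgradient h x p.
Proof.
move=> hc hl; apply: contrapT => /forallNP hx.
(* The translates [h (. + v)] converge to [h] as [v] tends to 0. *)
pose g (v : E) : E -> R := fun y => h (y + v).
have gl v : support_lipschitz P (g v).
  by move=> y z; have := hl (y + v) (z + v); rewrite opprD addrACA subrr addr0.
have gh y : g v y @[v --> (0 : E)] --> h y.
  have cv : y + v @[v --> (0 : E)] --> y + 0.
    exact: (@cvgD R E E (nbhs (0 : E)) _ (fun=> y) id y 0 (cvg_cst y) cvg_id).
  rewrite addr0 in cv.
  have ch : h z @[z --> y] --> h y by exact: (support_lipschitz_continuous cP P0 hl).
  exact: (cvg_comp _ h cv ch).
have hK p : ~ subgradient_image h [set x] p by move=> [_ ->]; exact: hx.
have near_p p : P p -> \forall q \near p & v \near (0 : E),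
    ~ subgradient_image (g v) [set x] q.
  move=> _; exact: (subgradient_image_near cP P0 (nbhs_filter (0 : E)) gl gh (@compact_set1 _ x) (hK p)).
have cov := (iffLR (compact_near_coveringP P) cP) _ (nbhs (0 : E))
  (fun v q => ~ subgradient_image (g v) [set x] q) _ near_p.
have /nbhs_ballP[e /= e0] : nbhs (0 : E)
  (fun v => P `<=` (fun q => ~ subgradient_image (g v) [set x] q)) := cov (nbhs_filter (0 : E)).
rewrite -ball_normE => ev.
have [y [p [yx py]]] := subgradient_dense x hc hl e0.
have yxe : ball_ Num.norm 0 e (y - x) by rewrite /= sub0r normrN.
apply: (ev _ yxe p (subgradient_lipschitz_sub cP P0 vP hl py)).
exists x => // z; rewrite /g [x + _]addrC subrK.
have -> : z - x = z + (y - x) - y by rewrite addrA addrAC addrK.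
exact: py.
Qed.

Lemma Vol_setD0 (A B : set E) : lebesgue_measurable A -> (Vol B < +oo)%E ->
  (Vol B <= Vol (B `&` A))%E -> Vol (B `\` A) = 0%E.
Proof.
move=> mA Boo BA; have split := Vol_split B mA.
have fin (C : set E) : C `<=` B -> Vol C \is a fin_num.
  by move=> CB; rewrite ge0_fin_numE ?Vol_ge0// (le_lt_trans (Vol_le CB)).
have f1 : Vol (B `&` A) \is a fin_num by apply: fin => p [].
have f2 : Vol (B `\` A) \is a fin_num by apply: fin => p [].
have := Vol_ge0 (B `\` A); move: split BA; rewrite -(fineK f1) -(fineK f2).
by move=> ->; rewrite -EFinD !lee_fin => *; congr EFin; lra.
Qed.

(** On the superlevel set [c < h - g] the subgradients of [h] are subgradients of
    [g], up to those not attained by [g]; as both have the same volume they agree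
    almost everywhere. Hence for almost every [p], attained by [h] at [x] and by
    [g] at [y], the values of [h - g] at [x] and [y] coincide, which makes [p] a
    subgradient of [h] at [y] too, and then [x = y] by uniqueness. *)
Lemma common_subgradient h g : support_lipschitz P h -> support_lipschitz P g ->
  Vol (subgradient_image h setT) = Vol P ->
  Vol (subgradient_image g setT) = Vol P ->
  (forall U : set E, open U ->
    Vol (subgradient_image h U) = Vol (subgradient_image g U)) ->
  exists2 Q : set E, Vol (P `\` Q) = 0%E &
    forall p, Q p -> exists z, subgradient h z p /\ subgradient g z p.
Proof.
move=> hl gl hP gP hg.
have attained f : support_lipschitz P f -> Vol (subgradient_image f setT) = Vol P ->
    Vol (P `\` subgradient_image f setT) = 0%E.
  move=> fl fP; apply: Vol_setD0.
  - by apply: (measurable_subgradient_open cP P0 vP fl); exact: openT.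
  - exact: Vol_compact.
  - by rewrite setIidr ?fP//; exact: subgradient_image_sub.
pose U (c : rat) : set E := [set x | ratr c < h x - g x].
have oU c : open (U c).
  apply: (open_comp (f := fun x => h x - g x) (D := [set r : R | ratr c < r])).
    move=> x _; have ch := support_lipschitz_continuous cP P0 hl (x:=x).
    have cg := support_lipschitz_continuous cP P0 gl (x:=x).
    exact: (cvgB ch cg).
  exact: open_gt.
have inc x y p : subgradient h x p -> subgradient g y p ->
    h x - g x <= h y - g y /\ (h y - g y <= h x - g x -> subgradient h y p).
  move=> hx gy; have hxy := hx y; have gyx := gy x.
  rewrite -(opprB x y) dotvNr in hxy; split; first lra.
  move=> le z; have := hx z; have -> : z - x = z - y - (x - y) by rewrite opprB addrA subrK.
  rewrite dotvBr; lra.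
pose N c := subgradient_image g (U c) `\` subgradient_image h (U c).
have N0 c : Vol (N c) = 0%E.
  apply: Vol_setD0.
  - exact: (measurable_subgradient_open cP P0 vP hl (oU c)).
  - by apply: le_lt_trans (Vol_compact cP); apply: Vol_le; exact: subgradient_image_sub.
  - rewrite -hg//; apply: (@le_trans _ _ (Vol (subgradient_image h (U c) `\`
        (P `\` subgradient_image g setT)))).
      by rewrite (Vol_setD_null _ (attained g gl gP)).
    apply: Vol_le => p [[x Ux hx] pN]; split; last by exists x.
    have [y _ gy] : subgradient_image g setT p.
      apply: contrapT => gp; apply: pN; split => //.
      exact: (subgradient_lipschitz_sub cP P0 vP hl hx).
    exists y => //; rewrite /U /=; apply: lt_le_trans Ux _.
    by have [] := inc _ _ _ hx gy.
pose Z := multi_subgradient h `|` ((P `\` subgradient_image h setT) `|`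
  ((P `\` subgradient_image g setT) `|` \bigcup_(c in [set: rat]) N c)).
have Z0 : Vol Z = 0%E.
  apply: Vol_nullU; first exact: (Vol_multi_subgradient cP P0 vP hl).
  apply: Vol_nullU; first exact: attained.
  apply: Vol_nullU; first exact: attained.
  by apply: Vol_null_bigcup => c _.
exists (P `\` Z).
  by apply: Vol_null_sub Z0 => p [Pp]; rewrite /= => /not_andP[//|/contrapT].
move=> p [Pp Zp].
have [x _ hx] : subgradient_image h setT p.
  by apply: contrapT => hp; apply: Zp; right; left.
have [y _ gy] : subgradient_image g setT p.
  by apply: contrapT => hp; apply: Zp; right; right; left.
have [le1 eq1] := inc _ _ _ hx gy.
suff le2 : h y - g y <= h x - g x by exists y; split => //; exact: eq1.
rewrite leNgt; apply/negP => /rat_in_itvoo[c]; rewrite in_itv /= => /andP[c1 c2].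
have [x' Ux' hx'] : subgradient_image h (U c) p.
  apply: contrapT => hp; apply: Zp; right; right; right; exists c => //.
  by split => //; exists y.
have [xx'|xx'] := eqVneq x x'; last by apply: Zp; left; exists x, x'.
by move: Ux'; rewrite -xx' /U /= ltNge (ltW c1).
Qed.


(** Fractions in the half-open interval from 0 to 1: in the subdivisions below the
    end [p] of the segment is treated apart. *)
Let frac (j m : nat) : R := j.+1%:R / m.+1%:R.

(** The points [q] that fail for given [j] and [m] form the image of a null set by a
    dilation. *)
Lemma radial_full (Q : set E) p : P p -> Vol (P `\` Q) = 0%E ->
  Vol (P `\` [set q | forall j m, (j <= m)%N -> Q (p + frac j m *: (q - p))]) = 0%E.
Proof.
move=> Pp PQ.
pose bad (jm : nat * nat) := [set (frac jm.1 jm.2)^-1 *: u +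
  (p - (frac jm.1 jm.2)^-1 *: p) | u in P `\` Q].
apply: (@Vol_null_sub _ _ _ (\bigcup_(jm in [set: nat * nat]) bad jm)).
  move=> q [Pq /existsNP[j /existsNP[m /not_implyP[jm Qjm]]]].
  have f0 : 0 < frac j m by rewrite divr_gt0.
  exists (j, m) => //; exists (p + frac j m *: (q - p)).
    split => //; apply: convex_set_segment => //.
    by rewrite (ltW f0) ler_pdivrMr// mul1r ler_nat ltnS.
  rewrite /= scalerDr scalerA mulVf ?gt_eqF// scale1r.
  by rewrite addrC addrA subrK addrC subrK.
apply: Vol_null_bigcup => -[j m] _; apply: Vol_null_affine => //.
by rewrite invr_gt0 divr_gt0.
Qed.

Lemma frac11 : frac 0 0 = 1.
Proof. by rewrite /frac divff. Qed.

Section GapConstant.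
Variables (h g : E -> R) (Q : set E) (z : E -> E).
Hypothesis zP : forall p, Q p -> subgradient h (z p) p /\ subgradient g (z p) p.
(** The difference at [p] of the convex conjugates of [h] and [g], which have the
    common subgradient [z p]. *)
Let D p := g (z p) - h (z p).

Lemma gap_step p q : Q p -> Q q -> `|D q - D p| <= dotv (q - p) (z q - z p).
Proof.
move=> /zP[hp gp] /zP[hq gq].
have := hp (z q); have := hq (z p); have := gp (z q); have := gq (z p).
have -> : z p - z q = - (z q - z p) by rewrite opprB.
rewrite !dotvNr dotvBl /D ler_norml => *; apply/andP; split; lra.
Qed.

(** On a segment subdivided into [m.+1] equal pieces the bounds of [gap_step] on
    the pieces telescope to a total of order [1 / m.+1]. *)
Lemma gap_constant p q : Q p ->
  (forall j m, (j <= m)%N -> Q (p + frac j m *: (q - p))) -> D q = D p.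
Proof.
move=> Qp Qpq.
have Qq : Q q by have := Qpq 0%N 0%N isT; rewrite frac11 scale1r addrC subrK.
have bound m : `|D q - D p| <= m.+1%:R^-1 * dotv (q - p) (z q - z p).
  pose u j := p + (j%:R / m.+1%:R) *: (q - p).
  have Qu j : (j <= m.+1)%N -> Q (u j).
    case: j => [_|j jm]; first by rewrite /u mul0r scale0r addr0.
    exact: Qpq.
  have u0 : u 0%N = p by rewrite /u mul0r scale0r addr0.
  have um : u m.+1 = q by rewrite /u divff// scale1r addrC subrK.
  have step j : u j.+1 - u j = m.+1%:R^-1 *: (q - p).
    by rewrite /u opprD addrACA subrr add0r -scalerBl -mulrBl -natr1 addrAC subrr add0r mul1r.
  suff ind j : (j <= m.+1)%N ->
      `|D (u j) - D p| <= m.+1%:R^-1 * dotv (q - p) (z (u j) - z p).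
    by have := ind m.+1 (leqnn _); rewrite um.
  elim: j => [_|j IH jm]; first by rewrite u0 !subrr dotv0r mulr0 normr0.
  have -> : D (u j.+1) - D p = (D (u j.+1) - D (u j)) + (D (u j) - D p).
    by rewrite addrA subrK.
  apply: le_trans (ler_normD _ _) _.
  have -> : z (u j.+1) - z p = (z (u j.+1) - z (u j)) + (z (u j) - z p).
    by rewrite addrA subrK.
  rewrite dotvDr mulrDr lerD ?IH 1?ltnW//.
  have := gap_step (Qu j (ltnW jm)) (Qu j.+1 jm).
  by rewrite step dotvZl.
apply/eqP; rewrite -subr_eq0 -normr_le0 leNgt; apply/negP => d0.
have B0 : 0 < dotv (q - p) (z q - z p).
  by have := bound 0%N; rewrite invr1 mul1r; exact: lt_le_trans.
have [m] := ltr_add_invr (divr_gt0 d0 B0); rewrite add0r ltr_pdivlMr//.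
by rewrite ltNge bound.
Qed.

End GapConstant.

(** Every affine minorant [p] of [h] at [x] is a limit of affine minorants in [Q]
    along a segment [p_s]; monotonicity along it bounds the contact points [z_s]
    in the only direction that matters. *)
Lemma gap_le h g (Q : set E) (c : R) : (0 < Vol P)%E -> convex_on_rV h ->
  support_lipschitz P h -> Vol (P `\` Q) = 0%E ->
  (forall p, Q p -> exists z,
    [/\ subgradient h z p, subgradient g z p & g z - h z = c]) ->
  forall x, h x + c <= g x.
Proof.
move=> VP0 hc hl PQ Qz x.
have [p hp] := subgradient_exists x hc hl.
have Pp := subgradient_lipschitz_sub cP P0 vP hl hp.
have [q [Pq Qq]] : exists q, P q /\
    forall j m, (j <= m)%N -> Q (p + frac j m *: (q - p)).
  apply: contrapT => /forallNP none; move: VP0; rewrite -(radial_full Pp PQ).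
  rewrite lt_neqAle => /andP[/eqP + _]; apply.
  by congr (Vol _); apply/seteqP; split => [q []//|q Pq]; split => // Qq; apply: (none q).
have [zq [hq gq _]] : exists z, [/\ subgradient h z q, subgradient g z q & g z - h z = c].
  by apply: Qz; have := Qq 0%N 0%N isT; rewrite frac11 scale1r addrC subrK.
have bound m : h x + c + m.+2%:R^-1 * dotv (q - p) (x - zq) <= g x.
  pose s : R := m.+2%:R^-1.
  have s0 : 0 < s by rewrite invr_gt0.
  have s1 : 0 < 1 - s by rewrite subr_gt0 invf_lt1// ltr1n.
  have [zs [hs gs zsc]] := Qz _ (Qq 0%N m.+1 isT).
  rewrite /frac mul1r -/s in hs gs.
  have mono : 0 <= dotv (q - p) (zq - zs).
    have := subgradient_monotone hq hs.
    have -> : q - (p + s *: (q - p)) = (1 - s) *: (q - p).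
      by rewrite opprD addrA scalerBl scale1r.
    by rewrite dotvZl pmulr_rge0.
  have := gs x; have := hp zs; rewrite -/s dotvDl dotvZl.
  have := ler_wpM2l (ltW s0) mono; rewrite mulr0 !dotvBr; lra.
rewrite leNgt -subr_gt0; apply/negP => d0 {VP0 PQ}.
have B0 : 0 < - dotv (q - p) (x - zq).
  rewrite ltNge oppr_le0; apply/negP => B0.
  have i0 : 0 <= 2%:R^-1 :> R by rewrite invr_ge0.
  have := bound 0%N; have := mulr_ge0 i0 B0; lra.
have [m] := ltr_add_invr (divr_gt0 d0 B0); rewrite add0r ltr_pdivlMr//.
have := bound m; have lt : m.+2%:R^-1 <= m.+1%:R^-1 :> R by rewrite lef_pV2 ?posrE// ler_nat.
have := ler_wpM2r (ltW B0) lt.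
move: (dotv (q - p) (x - zq)) (m.+2%:R^-1 : R) (m.+1%:R^-1 : R) => B i j *; lra.
Qed.

Lemma uniqueness h g : (0 < Vol P)%E -> convex_on_rV h -> convex_on_rV g ->
  support_lipschitz P h -> support_lipschitz P g ->
  Vol (subgradient_image h setT) = Vol P ->
  Vol (subgradient_image g setT) = Vol P ->
  (forall U : set E, open U ->
    Vol (subgradient_image h U) = Vol (subgradient_image g U)) ->
  exists c : R, forall x, g x = h x + c.
Proof.
move=> VP0 hc gc hl gl hP gP hg.
have [Q PQ Qz] := common_subgradient hl gl hP gP hg.
have zex p : exists z, Q p -> subgradient h z p /\ subgradient g z p.
  by have [/Qz[z zp]|Qp] := pselect (Q p); [exists z|exists 0].
have [z zP] := choice zex.
have [p [Pp Qp]] : exists p, P p /\ Q p.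
  apply: contrapT => /forallNP none; move: VP0; rewrite -PQ.
  rewrite lt_neqAle => /andP[/eqP + _]; apply.
  by congr (Vol _); apply/seteqP; split => [q []//|q Pq]; split => // Qq; apply: (none q).
pose S := [set q | forall j m, (j <= m)%N -> Q (p + frac j m *: (q - p))].
have PS : Vol (P `\` S) = 0%E := radial_full Pp PQ.
have zS q : S q -> [/\ subgradient h (z q) q, subgradient g (z q) q &
    g (z q) - h (z q) = g (z p) - h (z p)].
  move=> Sq; have [hq gq] : subgradient h (z q) q /\ subgradient g (z q) q.
    by apply: zP; have := Sq 0%N 0%N isT; rewrite frac11 scale1r addrC subrK.
  by split => //; exact: (gap_constant zP Qp Sq).
exists (g (z p) - h (z p)) => x; apply/eqP; rewrite eq_le; apply/andP; split.
  rewrite -lerBlDr; apply: (gap_le VP0 gc gl PS) => q /zS[hq gq hgq].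
  by exists (z q); split => //; rewrite -hgq opprB.
by apply: (gap_le VP0 hc hl PS) => q /zS[hq gq hgq]; exists (z q).
Qed.

End Uniqueness.

(** * The Monge-Ampere equation *)

Theorem theorem7p3 (R : realType) (n : nat) (P : set 'rV[R]_n)
    (mu : {measure set (borel_rV R n) -> \bar R}) :
  convex_body P ->
  mu setT = MA (support_function P) setT ->
  exists h : 'rV[R]_n -> R,
    [/\ class_E P h,
        (forall A : set (borel_rV R n), measurable A -> MA h A = mu A)
      & forall g : 'rV[R]_n -> R, class_E P g ->
          (forall A : set (borel_rV R n), measurable A -> MA g A = mu A) ->
          exists c : R, forall x, g x = h x + c].
Proof.
move=> [cP vP intP] muP.
have P0 : P !=set0 by case: intP => p /interior_subset; exists p.
have VP0 : (0 < Vol P)%E.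
  apply: lt_le_trans (Vol_open_gt0 (@open_interior _ P) intP) _.
  exact: Vol_le (@interior_subset _ P).
pose k : R := n`!%:R / 2 ^+ n.
have k0 : 0 < k by rewrite divr_gt0// ?ltr0n ?fact_gt0// exprn_gt0.
have MAE h (A : set 'rV[R]_n) : MA h A = (k%:E * Vol (subgradient_image h A))%E by [].
have ki0 : 0 <= k^-1 by rewrite invr_ge0 ltW.
have cancel_k (v w : \bar R) : (k%:E * v)%E = (k%:E * w)%E -> v = w.
  move=> /(congr1 (fun u => k^-1%:E * u)%E).
  by rewrite !muleA -EFinM mulVf ?gt_eqF// !mul1e.
pose nu := mscale (NngNum ki0) mu.
have nuE (A : set (borel_rV R n)) : (k%:E * nu A)%E = mu A.
  by rewrite /nu /mscale /= muleA -EFinM mulfV ?gt_eqF// mul1e.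
have nuP : nu setT = Vol P.
  by apply: cancel_k; rewrite nuE muP MAE subgradient_image_support.
have [h [hc hl hnu]] := exists_solution cP P0 vP nuP VP0.
have hmu (A : set (borel_rV R n)) : measurable A -> MA h A = mu A.
  by move=> mA; rewrite MAE -nuE; congr (_ * _)%E; exact: hnu.
exists h; split => //.
  split; first exact: lipschitz_class_L.
  by rewrite -muP; exact: hmu measurableT.
move=> g [gL gP] gmu; have gl := class_L_lipschitz cP P0 gL.
apply: (uniqueness cP P0 vP VP0 hc gL.1 hl gl).
- by rewrite (hnu setT measurableT).
- by apply: cancel_k; rewrite -MAE gP MAE subgradient_image_support.
- move=> U /borel_open mU.
  by apply: cancel_k; rewrite -!MAE gmu// hmu.
Qed.
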